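(* There exist a universal constant $C<\infty$ and a single randomized algorithm, which is an implementation of the acceptance-complement method (as defined in the context), such that the following holds for every log-concave probability density $f$ on $\mathbb{R}$ and every mode $m$ of $f$. When the algorithm is given the value of $m$ and access to a black box that returns the value $f(x)$ at any queried point $x\in\mathbb{R}$ (and no other information about $f$), it halts after at most $C$ steps and outputs a random variate $X$ with density $f$. The constant $C$ depends neither on $f$ nor on $m$, nor on the outcome of the random draws.
   Context: A probability density $f$ on $\mathbb{R}$ is log-concave if $\log f:\mathbb{R}\to[-\infty,\infty)$ is concave. A mode of $f$ is a point $m$ with $f(m)=\sup_{x} f(x)$. Computational model: exact real arithmetic, with a source of independent uniform $[0,1]$ random variates of infinite precision. One step is one query to the black box for $f$, one draw of a uniform $[0,1]$ variate, one arithmetic operation or comparison (branch) on real numbers, or one evaluation of an elementary function such as $\exp$ or $\log$. Acceptance-complement method for a density $f$ on $\mathbb{R}$: one chooses nonnegative integrable functions $r$ and $q$ on $\mathbb{R}$ such that $0\le r\le f\le q+r$ and $\int q\le 1$, and such that one can generate random variates with density proportional to $r$ and random variates with density proportional to $q$. The method then proceeds as follows. Let $V$ be uniform on $[0,1]$. If $V\ge 1-\int q$, generate $Y$ with density proportional to $q$ and an independent uniform $[0,1]$ variate $U$; if $U q(Y)\le f(Y)-r(Y)$, return $X=Y$ and halt. In all other cases, return an independently generated $X$ with density proportional to $r$. (All random variates used are independent. When $\int q=1$ the first test is always passed.) An implementation of the method must construct $r$ and $q$, compute the quantities used in the tests, and generate the variates from $r$ and $q$, all within the computational model and with the information availabl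e. *)

(* Defs.v *)
From HB Require Import structures.
From mathcomp Require Import all_boot all_order all_algebra.
From mathcomp Require Import all_classical all_reals all_analysis.
Set Implicit Arguments.
Unset Strict Implicit.
Unset Printing Implicit Defensive.
Import Order.TTheory GRing.Theory Num.Theory.
Import numFieldNormedType.Exports.
Local Open Scope classical_set_scope.
Local Open Scope ring_scope.

Section Densities.
Context {R : realType}.
Implicit Types (f g r q : R -> R) (m : R).
Local Notation mu := (@lebesgue_measure R).

Definition density f : Prop :=
  [/\ measurable_fun setT f, (forall x, 0 <= f x)
    & (\int[mu]_x (f x)%:E)%E = 1%E].

(* [lne] takes values in the extended reals, with [lne 0 = -oo]; the
   convention [0 * -oo = 0] makes the endpoints t = 0, 1 trivial. *)
Definition log_concave f : Prop :=
  forall (x y t : R), 0 <= t <= 1 ->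
    (t%:E * lne (f x)%:E + (1 - t)%:E * lne (f y)%:E
       <= lne (f (t * x + (1 - t) * y)%R)%:E)%E.

(* The supremum is taken in [\bar R] since the real-valued [sup] of an
   unbounded set is a junk value. *)
Definition mode f m : Prop := (f m)%:E = ereal_sup [set (f x)%:E | x in setT].

Definition integ g : R := Rintegral mu setT g.

Definition ac_pair f r q : Prop :=
  [/\ (forall x, 0 <= r x /\ 0 <= q x),
      (forall x, r x <= f x <= q x + r x),
      mu.-integrable setT (EFin \o r),
      mu.-integrable setT (EFin \o q)
    & integ q <= 1].

Definition has_density d (T : measurableType d) (P : probability T R)
    (X : {RV P >-> R}) g : Prop :=
  forall A : set R, measurable A ->
    distribution P X A = (\int[mu]_(x in A) (g x)%:E)%E.

Definition in_unit (u : nat -> R) : Prop := forall k, 0 <= u k <= 1.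

Definition iid_uniform d (T : measurableType d) (P : probability T R)
    (U : nat -> {RV P >-> R}) : Prop :=
  [/\ (forall w, in_unit (fun k => U k w)),
      (forall k (A : set R), measurable A ->
         distribution P (U k) A = uniform_prob (@ltr01 R) A)
    & (forall (J : seq nat) (A : nat -> set R), uniq J ->
         (forall k, measurable (A k)) ->
         P [set w | forall k, k \in J -> A k (U k w)]
         = (\prod_(k <- J) P (U k @^-1` A k))%E)].

End Densities.

(* Programs for a machine with exact real registers, indexed by nat.  The first
   argument of each of the first six instructions is the destination register.
   Natural constants are the only ones available. *)
Inductive arith := Add | Sub | Mul | Div.
Inductive elementary := Exp | Ln.

Inductive instr :=
  | Const of nat & nat
  | Copy  of nat & nat
  | Arith of arith & nat & nat & nat
  | Elem  of elementary & nat & nat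
  | Query of nat & nat
  | Draw  of nat
  | If    of nat & nat & seq instr & seq instr
  | While of nat & nat & seq instr.

Definition prog := seq instr.

Section Machine.
Context {R : realType}.
Implicit Types (f : R -> R) (u s : nat -> R) (p : prog).

Definition arith_op (o : arith) (x y : R) : R :=
  match o with
  | Add => x + y | Sub => x - y | Mul => x * y | Div => x / y
  end.

Definition elem_op (o : elementary) (x : R) : R :=
  match o with Exp => expR x | Ln => ln x end.

Definition upd s i x : nat -> R := fun j => if j == i then x else s j.

(* Remaining code, registers, number of uniform variates drawn so far. *)
Definition config : Type := prog * (nat -> R) * nat.

(* Each transition is one unit of cost; a configuration with no remaining code
   is halted, and is a fixed point.  [If i j p1 p2] and [While i j p] test
   [s i <= s j].  The black box is [f], and [u] is the stream of variates. *)
Definition step f u (c : config) : config :=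
  let: (p, s, k) := c in
  match p with
  | [::] => c
  | Const i n :: p' => (p', upd s i n%:R, k)
  | Copy i j :: p' => (p', upd s i (s j), k)
  | Arith o i j l :: p' => (p', upd s i (arith_op o (s j) (s l)), k)
  | Elem o i j :: p' => (p', upd s i (elem_op o (s j)), k)
  | Query i j :: p' => (p', upd s i (f (s j)), k)
  | Draw i :: p' => (p', upd s i (u k), k.+1)
  | If i j p1 p2 :: p' => ((if s i <= s j then p1 else p2) ++ p', s, k)
  | While i j p1 :: p' =>
      ((if s i <= s j then p1 ++ p else p'), s, k)
  end.

Definition run f u (t : nat) (c : config) : config := iter t (step f u) c.

Definition halted (c : config) : Prop := c.1.1 = [::].

Definition register (c : config) (i : nat) : R := c.1.2 i.

(* Started on registers [s], [p] halts with [x] in register [i], the other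
   registers below [n] being unchanged. *)
Definition returns f u (n : nat) p s (i : nat) (x : R) : Prop :=
  exists t s' k, [/\ run f u t (p, s, 0%N) = ([::], s', k), s' i = x
    & forall j, (j < n)%N -> j != i -> s' j = s j].

Definition evaluates f n p s i x : Prop :=
  forall u, in_unit u -> returns f u n p s i x.

(* No law is required when g is almost everywhere zero, but the routine must
   still halt. *)
Definition generates f n p s i (g : R -> R) : Prop :=
  (forall u, in_unit u -> exists x, returns f u n p s i x) /\
  (0 < integ g ->
   forall d (T : measurableType d) (P : probability T R)
     (U : nat -> {RV P >-> R}), iid_uniform U ->
   exists X : {RV P >-> R},
     (forall w, returns f (fun k => U k w) n p s i (X w)) /\
     has_density X (fun x => g x / integ g)).

End Machine.

(* Registers of the method: output X, variates V and U, candidate Y, values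
   q(Y), r(Y), f(Y), a temporary, the mode m, and the integral of q. *)
Definition rX : nat := 0%N. Definition rV : nat := 1%N. Definition rU : nat := 2%N. Definition rY : nat := 3%N.
Definition rQ : nat := 4%N. Definition rR : nat := 5%N. Definition rF : nat := 6%N. Definition rT : nat := 7%N.
Definition rM : nat := 8%N. Definition rI : nat := 9%N.

(* The set-up stores a description of r and q in [ac_data] registers, from
   register 10 on; the other four routines use these, and may use all later
   registers as scratch memory. *)
Record ac_impl := AcImpl {
  ac_data : nat;
  ac_setup : prog;
  ac_gen_q : prog;
  ac_gen_r : prog;
  ac_eval_q : prog;
  ac_eval_r : prog }.

Definition ac_mem (A : ac_impl) : nat := (10 + ac_data A)%N.

Definition ac_program (A : ac_impl) : prog :=
  ac_setup A ++
  [:: Draw rV; Const rT 1; Arith Sub rT rT rI;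
      If rT rV
        (ac_gen_q A ++ [:: Draw rU] ++ ac_eval_q A ++ ac_eval_r A ++
         [:: Query rF rY; Arith Sub rF rF rR; Arith Mul rT rU rQ;
             If rT rF [:: Copy rX rY] (ac_gen_r A)])
        (ac_gen_r A)].

Section AcceptanceComplement.
Context {R : realType}.
Implicit Types (f r q : R -> R) (s u : nat -> R) (A : ac_impl).

Definition init (m : R) : nat -> R := upd (fun=> 0) rM m.

Definition ac_start A (m : R) : config := (ac_program A, init m, 0%N).

Definition ac_routines A f r q s : Prop :=
  [/\ generates f (ac_mem A) (ac_gen_q A) s rY q,
      generates f (ac_mem A) (ac_gen_r A) s rX r,
      evaluates f (ac_mem A) (ac_eval_q A) s rQ (q (s rY))
    & evaluates f (ac_mem A) (ac_eval_r A) s rR (r (s rY))].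

(* The functions r and q depend on f and m, but not on the random draws.  The
   routines must be correct whatever the values of V, U, Y, ... and of the
   scratch registers, as long as the result of the set-up is intact. *)
Definition ac_implements A f (m : R) : Prop :=
  exists r q, ac_pair f r q /\
    forall u, in_unit u ->
    exists t s0 k,
      [/\ run f u t (ac_setup A, init m, 0%N) = ([::], s0, k),
          s0 rI = integ q
        & forall s, (forall i, (8 <= i < ac_mem A)%N -> s i = s0 i) ->
            ac_routines A f r q s].

End AcceptanceComplement.

(* Main.v *)
(* Let [M = f m].  Cut the interval of radius [16 / M] around [m] into 128 cells
   of width [1 / (4 M)].  As [f] is monotone on either side of [m], it lies on
   each cell between its values at the two ends; [r] is the step function of the
   smaller ones and [q] that of the differences, whose sum telescopes, so this
   part of [q] has mass [2 M * 1 / (4 M) = 1/2] (the values at the two extreme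
   ends are taken to be [0]).  Log-concavity at the midpoint of [m] and [x] gives
   [f x <= 4 / (M (x - m)^2)]; adding this bound to [q] outside the interval costs
   another [2 * 1/4].  Both functions are sampled by inverting their distribution
   functions, with one uniform variate and a fixed number of steps. *)
Require Import Defs.
From HB Require Import structures.
From mathcomp Require Import all_boot all_order all_algebra.
From mathcomp Require Import all_classical all_reals all_analysis.
From mathcomp Require Import measurable_realfun.
From mathcomp Require Import lra ring zify.
Import Order.TTheory GRing.Theory Num.Theory.
Import numFieldNormedType.Exports.
Local Open Scope classical_set_scope.
Local Open Scope ring_scope.

(** * Loop-free programs *)

(** Plain rejection repeats until acceptance and so has no bound on its running time. Here a refused
    candidate is replaced once and for all: accepted candidates account for the mass of [f - r], so
    refusal has probability exactly the mass of [r], and a single draw from the normalised [r]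
    supplies what is missing. The price is a [q] above [f - r] of mass at most [1], on a number of
    cells fixed before [f] is known. The height [M] is the only scale at hand, and it suffices. Half
    of the mass is granted to the tails: two tails of mass [4 / (M K)] beyond distance [K] give
    [K = 16 / M]. The other half goes to the cells: differences of sum [2 M] give the width
    [1 / (4 M)]. The quotient is [64] cells on each side for every [f]. As the mass of [q] is then
    exactly [1], the test on [V] always passes; the mass of [r] varies with [f] but is a finite sum
    that a program can compute. Log-concavity enters only through monotonicity on each side of [m]
    and the midpoint inequality. The laws of both samplers are expressed by one relation,
    [transports], which is stable under gluing. *)

Lemma instr_nested_ind (P : instr -> Prop) :
  (forall i n, P (Const i n)) -> (forall i j, P (Copy i j)) ->
  (forall o i j l, P (Arith o i j l)) -> (forall o i j, P (Elem o i j)) ->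
  (forall i j, P (Query i j)) -> (forall i, P (Draw i)) ->
  (forall i j p1 p2, List.Forall P p1 -> List.Forall P p2 -> P (If i j p1 p2)) ->
  (forall i j p, P (While i j p)) ->
  forall i, P i.
Proof.
(* The nested lists in [If] call for a recursion on [instr] combined with one on each list; the
   automatically generated principle gives no hypothesis for list members. *)
move=> Pc Pcp Pa Pe Pq Pd Pi Pw; fix IH 1.
intros [i n|i j|o i j l|o i j|i j|i|i j p1 p2|i j p].
- exact: Pc.
- exact: Pcp.
- exact: Pa.
- exact: Pe.
- exact: Pq.
- exact: Pd.
- apply: Pi.
  + elim: p1 => [|x p IHp]; constructor; [exact: IH|exact: IHp].
  + elim: p2 => [|x p IHp]; constructor; [exact: IH|exact: IHp].
- exact: Pw.
Qed.

Section Semantics.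
Context {R : realType}.
Implicit Types (f : R -> R) (u s : nat -> R) (p : prog) (k : nat).

(* [While] is a no-op here: the denotation is only meant for programs without
   it, which [writes_in] below rejects. *)
Fixpoint exec1 f u (i : instr) (c : (nat -> R) * nat) {struct i} :
    (nat -> R) * nat :=
  let: (s, k) := c in
  match i with
  | Const i n => (upd s i n%:R, k)
  | Copy i j => (upd s i (s j), k)
  | Arith o i j l => (upd s i (arith_op o (s j) (s l)), k)
  | Elem o i j => (upd s i (elem_op o (s j)), k)
  | Query i j => (upd s i (f (s j)), k)
  | Draw i => (upd s i (u k), k.+1)
  | If i j p1 p2 =>
      if s i <= s j then foldl (fun c i => exec1 f u i c) (s, k) p1
      else foldl (fun c i => exec1 f u i c) (s, k) p2
  | While _ _ _ => c
  end.

Definition exec f u p c := foldl (fun c i => exec1 f u i c) c p.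

Lemma exec_cat f u p1 p2 c : exec f u (p1 ++ p2) c = exec f u p2 (exec f u p1 c).
Proof. exact: foldl_cat. Qed.

Lemma exec_If f u i j p1 p2 s k : exec f u [:: If i j p1 p2] (s, k) =
  if s i <= s j then exec f u p1 (s, k) else exec f u p2 (s, k).
Proof. by []. Qed.

Lemma exec_nseq f u p n c :
  exec f u (flatten (nseq n p)) c = iter n (exec f u p) c.
Proof. by elim: n c => //= n IH c; rewrite exec_cat IH -iterSr iterS. Qed.

End Semantics.

(** Both branches are charged: an overestimate, but one that can be read off the text, whatever
    branch is taken. *)
Fixpoint cost1 (i : instr) : nat :=
  match i with
  | If _ _ p1 p2 => (sumn (map cost1 p1) + sumn (map cost1 p2)).+1
  | _ => 1
  end.

Definition cost (p : prog) : nat := sumn (map cost1 p).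

(** One boolean check serves two ends: absence of loops, hence termination, and a frame condition
    for the registers outside [D]. *)
Fixpoint writes_in1 (D : pred nat) (i : instr) : bool :=
  match i with
  | Const i _ | Copy i _ | Arith _ i _ _ | Elem _ i _ | Query i _ | Draw i => D i
  | If _ _ p1 p2 => all (writes_in1 D) p1 && all (writes_in1 D) p2
  | While _ _ _ => false
  end.

Definition writes_in (D : pred nat) (p : prog) : bool := all (writes_in1 D) p.

Section SemanticsTheory.
Context {R : realType}.
Implicit Types (f : R -> R) (u s : nat -> R) (p : prog) (k : nat).

(** The number of steps depends on the branches taken, so it is only bounded; [rest] makes the
    property compose along a program. *)
Definition simulates f u p n := forall rest s k, exists2 t, (t <= n)%N &
  run f u t (p ++ rest, s, k) =
  (rest, (exec f u p (s, k)).1, (exec f u p (s, k)).2).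

Lemma run1_simulates f u D i :
  writes_in1 D i -> simulates f u [:: i] (cost1 i).
Proof.
elim/instr_nested_ind: i => /=; do 6?[by move=> *; exists 1%N].
- move=> i j p1 p2 IH1 IH2 /andP[D1 D2].
  have seqE p : List.Forall (fun i => writes_in1 D i ->
      simulates f u [:: i] (cost1 i)) p -> all (writes_in1 D) p ->
      simulates f u p (cost p).
    elim=> [_ rest s k|x q hx _ IHq /= /andP[Dx Dq] rest s k].
      by exists 0%N.
    have [t1 t1n e1] := hx Dx (q ++ rest) s k.
    move: e1; rewrite /= /exec /=; case: exec1 => s' k' /= e1.
    have [t2 t2n e2] := IHq Dq rest s' k'.
    exists (t2 + t1)%N; first by rewrite addnC /cost /= leq_add.
    by rewrite /run iterD -/(run f u t1 _) e1.
  move=> rest s k; rewrite /exec /=.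
  case: ifPn => sij.
    have [t tn e] := seqE _ IH1 D1 rest s k.
    exists t.+1; first by rewrite ltnS (leq_trans tn) ?leq_addr.
    by rewrite /run iterSr /= sij.
  have [t tn e] := seqE _ IH2 D2 rest s k.
  exists t.+1; first by rewrite ltnS (leq_trans tn) ?leq_addl.
  by rewrite /run iterSr /= (negbTE sij).
Qed.

Lemma run_simulates f u D p : writes_in D p -> simulates f u p (cost p).
Proof.
elim: p => [_ rest s k|x q IHq /= /andP[Dx Dq] rest s k]; first by exists 0%N.
have [t1 t1n e1] := run1_simulates f u _ _ Dx (q ++ rest) s k.
move: e1; rewrite /= /exec /=; case: exec1 => s' k' /= e1.
have [t2 t2n e2] := IHq Dq rest s' k'.
exists (t2 + t1)%N; first by rewrite addnC /cost /= leq_add.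
by rewrite /run iterD -/(run f u t1 _) e1.
Qed.

(** Halted configurations are fixed points, so the varying number of steps can be padded to any
    common bound. *)
Lemma run_halted f u t p s k D : writes_in D p -> (cost p <= t)%N ->
  run f u t (p, s, k) = ([::], (exec f u p (s, k)).1, (exec f u p (s, k)).2).
Proof.
move=> Dp pt; have [t' t'n] := run_simulates f u _ _ Dp [::] s k.
rewrite cats0 => e; rewrite -(subnK (leq_trans t'n pt)) /run iterD.
by rewrite -/(run f u t' _) e; elim: (t - t')%N => //= n ->.
Qed.

Lemma exec1_frame f u D i j s k : writes_in1 D i -> ~~ D j ->
  (exec1 f u i (s, k)).1 j = s j.
Proof.
move=> Di Dj; move: i s k Di.
have updE s i x : D i -> upd s i x j = s j.
  by rewrite /upd; case: eqP => // <-; rewrite (negbTE Dj).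
elim/instr_nested_ind => /=; do 6?[by move=> *; exact: updE]; last by [].
move=> i l p1 p2 IH1 IH2 s k /andP[D1 D2].
have seqE p : List.Forall (fun i => forall s k, writes_in1 D i ->
    (exec1 f u i (s, k)).1 j = s j) p -> all (writes_in1 D) p ->
    forall s k, (foldl (fun c i => exec1 f u i c) (s, k) p).1 j = s j.
  elim=> //= x q hx _ IHq /andP[Dx Dq] s' k'.
  move: (hx s' k' Dx); case: exec1 => s'' k'' /= <-.
  exact: IHq.
by case: ifPn => _; rewrite seqE.
Qed.

Lemma exec_frame f u D p j s k : writes_in D p -> ~~ D j ->
  (exec f u p (s, k)).1 j = s j.
Proof.
move=> Dp Dj; elim: p s k Dp => //= x q IHq s k /andP[Dx Dq].
have := exec1_frame f u _ _ _ s k Dx Dj.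
by rewrite /exec /=; case: exec1 => s' k' /= <-; exact: IHq.
Qed.

Lemma returns_exec f u n p s i x :
  writes_in (fun j => (n <= j)%N || (j == i)) p ->
  (exec f u p (s, 0%N)).1 i = x -> returns f u n p s i x.
Proof.
move=> Dp ex; exists (cost p), (exec f u p (s, 0%N)).1, (exec f u p (s, 0%N)).2.
split=> //; first exact: (run_halted _ _ _ _ _ _ _ Dp).
move=> j jn ji; rewrite (exec_frame _ _ _ _ _ _ _ Dp)//.
by rewrite negb_or -ltnNge jn.
Qed.

End SemanticsTheory.

(** * Inversion samplers *)

Section DensityMeasure.
Context {R : realType} (g : R -> R).
Local Notation mu := (@lebesgue_measure R).

(** The proofs [mg] and [g0] are arguments so that the measure structure can be found from the term
    itself. *)
Definition density_measure (mg : measurable_fun setT g)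
    (g0 : forall x, 0 <= g x) (A : set R) : \bar R :=
  (\int[mu]_(x in A) (g x)%:E)%E.

Context (mg : measurable_fun setT g) (g0 : forall x, 0 <= g x).
Local Notation nu := (density_measure mg g0).

Let nu0 : nu set0 = 0%E.
Proof. exact: integral_set0. Qed.

Let nu_ge0 A : (0 <= nu A)%E.
Proof. by apply: integral_ge0 => x _; rewrite lee_fin. Qed.

Let nu_sigma_additive : semi_sigma_additive nu.
Proof.
move=> F mF tF mUF; apply: cvg_toP.
  apply: ereal_nondecreasing_is_cvgn => m n mn.
  by apply: lee_sum_nneg_natr => // k _ _; exact: nu_ge0.
rewrite [RHS]/density_measure ge0_integral_bigcup//=.
- by apply: measurable_funTS; exact: measurableT_comp.
- by move=> x _; rewrite lee_fin.
Qed.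

HB.instance Definition _ := isMeasure.Build _ _ _ nu
  nu0 nu_ge0 nu_sigma_additive.

End DensityMeasure.

(** * Images of Lebesgue measure under inverse distribution functions *)

Section MeasureUnique.
Context {R : realType}.
Local Notation mu := (@lebesgue_measure R).

(** The intervals []x, y]] are stable under intersection, generate the Borel sets, and those with
    ends [-k] and [k] exhaust the line. *)
Lemma measure_unique_itvoc (m1 m2 : {measure set R -> \bar R}) :
  (forall x y, x < y -> m1 `]x, y]%classic = m2 `]x, y]%classic) ->
  (forall x y, (m1 `]x, y]%classic < +oo)%E) ->
  forall A, measurable A -> m1 A = m2 A.
Proof.
move=> m12 m1oo A mA.
have := (@measure_unique _ R R (@ocitv R) (fun k : nat => `] (- k%:R)%R, k%:R]%classic) erefl _ _ _ m1 m2 _ _ A mA); apply.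
- exact: ocitvI.
- by move=> k; exact: is_ocitv.
- by rewrite bigcup_itvT.
- by move=> _ /ocitvP[->|[x x12 ->]]; [rewrite !measure0|exact: m12].
- by move=> k; exact: m1oo.
Qed.

(** The image under [psi] of Lebesgue measure on [D] has density [g]. Nothing is normalised, so that
    the unit interval of variates can be cut into pieces treated separately. *)
Definition transports (D : set R) (psi g : R -> R) :=
  forall A, measurable A ->
    mu (D `&` psi @^-1` A) = (\int[mu]_(x in A) (g x)%:E)%E.

Lemma transports_itvoc (D : set R) (psi g : R -> R) : measurable D -> (mu D < +oo)%E ->
  measurable_fun setT psi -> measurable_fun setT g -> (forall x, 0 <= g x) ->
  (forall x y, x < y -> mu (D `&` psi @^-1` `]x, y]) =
     (\int[mu]_(t in `]x, y]) (g t)%:E)%E) ->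
  transports D psi g.
Proof.
move=> mD Doo mpsi mg g0 H A mA.
pose m1 := pushforward (mrestr mu mD) psi.
have mpre B : measurable B -> measurable (psi @^-1` B).
  by move=> mB; rewrite -[X in measurable X]setTI; exact: mpsi.
have m1E B : m1 B = mu (D `&` psi @^-1` B).
  by rewrite /m1 /pushforward /mrestr setIC.
rewrite -m1E.
pose psi' : {mfun (measurableTypeR R) >-> R} :=
  HB.pack psi (isMeasurableFun.Build _ _ (measurableTypeR R) R psi mpsi).
have := @measure_unique_itvoc (pushforward (mrestr mu mD) psi') (density_measure g mg g0).
apply => //.
- by move=> x y xy; rewrite [LHS]m1E H.
- move=> x y; rewrite [X in (X < _)%E]m1E (le_lt_trans _ Doo)//.
  by apply: le_measure; rewrite ?inE//; apply: measurableI => //; exact: mpre.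
Qed.

Lemma lebesgue_itvoc (x y : R) : mu `]x, y] = (Num.max 0 (y - x))%:E.
Proof.
rewrite lebesgue_measure_itv/= lte_fin; case: ifPn => xy.
  by rewrite max_r ?subr_ge0 1?ltW// EFinB.
by rewrite max_l// subr_le0 leNgt.
Qed.

(** Stretching by [1 / h] turns Lebesgue measure into the constant density [h]; the source has
    length [h * d], the mass of the target. *)
Lemma transports_cell (p c a d h : R) : 0 <= h -> c = h * d -> 
  transports `]p, p + c] (fun w => a + (w - p) / h)
    (fun x => h * \1_`]a, a + d] x).
Proof.
move=> h0 ->.
have mg : measurable_fun setT (fun x => h * \1_`]a, a + d] x : R).
  by apply: measurable_funM => //; exact: measurable_indic.
apply: transports_itvoc => //.
- by rewrite lebesgue_itvoc ltry.
- apply: measurable_funD => //; apply: measurable_funM => //.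
  exact: measurable_funB.
- by move=> x; rewrite mulr_ge0.
move=> x y xy.
transitivity (h%:E * mu (`]x, y] `&` `]a, (a + d)%R]))%E; last first.
  under eq_integral do rewrite EFinM.
  rewrite ge0_integralZl//=; last by apply: measurable_funTS; apply: measurableT_comp => //; exact: measurable_indic.
  by rewrite integral_indic// setIC.
have -> : `]x, y] `&` `]a, a + d] = `]Num.max x a, Num.min y (a + d)]%classic.
  apply/seteqP; split=> z /=; rewrite !in_itv/= gt_max le_min; first by move=> [/andP[-> ->] /andP[-> ->]].
  by move=> /andP[/andP[-> ->] /andP[-> ->]].
rewrite lebesgue_itvoc.
(* For [h = 0] the source interval is empty, so the value of the division by zero does not
   matter. *)
have [h00|h00] := eqVneq h 0.
  rewrite h00 !mul0r addr0 set_itv_ge ?bnd_simp ?ltxx// set0I measure0.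
  by rewrite mul0e.
have {h00}h0 : 0 < h by rewrite lt_neqAle eq_sym h00.
(* The affine map is increasing with inverse [t |-> p + h * (t - a)], hence preimages of intervals
   are intervals. *)
have ltE t z : (p + h * (t - a) < z) = (t < a + (z - p) / h).
  by rewrite -ltrBrDl mulrC -ltr_pdivlMr// ltrBlDl.
have leE t z : (z <= p + h * (t - a)) = (a + (z - p) / h <= t).
  by rewrite -lerBlDl mulrC -ler_pdivrMr// lerBrDl.
have -> : `]p, p + h * d] `&` (fun w : R => a + (w - p) / h) @^-1` `]x, y] =
   `]p + h * (Num.max x a - a), p + h * (Num.min y (a + d) - a)]%classic.
  have aE z : (p < z) = (a < a + (z - p) / h) by rewrite -ltE subrr mulr0 addr0.
  have dE z : (z <= p + h * d) = (a + (z - p) / h <= a + d).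
    by rewrite -leE addrAC subrr add0r.
  apply/seteqP; split=> z /=; rewrite !in_itv/= ltE leE gt_max le_min aE dE.
    by move=> [/andP[-> ->] /andP[-> ->]].
  by move=> /andP[/andP[-> ->] /andP[-> ->]].
rewrite lebesgue_itvoc -EFinM; congr EFin.
rewrite maxr_pMr ?ltW// mulr0; congr Num.max; ring.
Qed.

(** Once the discontinuity at [0], where the value is [0] by convention, is split off, a continuous
    function on an open set remains. *)
Lemma measurable_invr : measurable_fun setT (fun x : R => x^-1).
Proof.
rewrite (_ : (fun x => _) = fun x : R => if x == 0 then 0 else x^-1); last first.
  by apply/funext => x; case: eqP => // ->; rewrite invr0.
apply: measurable_fun_if => //.
  exact: measurable_fun_eqr.
rewrite setTI; apply: open_continuous_measurable_fun.
  rewrite (_ : _ @^-1` _ = [set x | x != 0]); first exact: open_neq.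
  by apply/seteqP; split => x /=; case: (x == 0).
by move=> x; rewrite inE/= => /negbT x0; exact: inv_continuous.
Qed.

Lemma is_derive_hyperbola (c m t : R) : t != m ->
  is_derive t 1 (fun t => - (c / (t - m))) (c / (t - m) ^+ 2).
Proof.
move=> tm; have tm0 : t - m != 0 by rewrite subr_eq0.
pose h : R -> R := fun t => t - m.
have dh : is_derive t 1 h 1.
  by apply: is_derive_eq; rewrite oppr0 addr0.
have dV := @is_deriveV _ h t 1 1 tm0 dh.
apply: is_derive_eq.
by rewrite /GRing.scale/= mulr1 mulrN opprK.
Qed.

(** The fundamental theorem of calculus applies because the pole [m] lies outside [[x, y]]. *)
Lemma integral_hyperbola (c m x y : R) : x < y -> (y < m) || (m < x) ->
  (\int[mu]_(t in `]x, y]) (c / (t - m) ^+ 2)%:E = (c / (x - m) - c / (y - m))%:E)%E.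
Proof.
move=> xy sep.
have neq t : x <= t <= y -> t != m.
  by move=> /andP[xt ty]; apply/eqP => tm; move: sep xt ty; rewrite tm; lra.
have dF t : x <= t <= y ->
    is_derive t 1 (fun t => - (c / (t - m))) (c / (t - m) ^+ 2).
  by move=> /neq; exact: is_derive_hyperbola.
have mg : measurable_fun setT (fun t : R => c / (t - m) ^+ 2).
  apply: measurable_funM => //; apply: (measurableT_comp measurable_invr).
  by apply: measurable_funX; exact: measurable_funB.
have cF t : x <= t <= y -> {for t, continuous (fun t => - (c / (t - m)))}.
  by move=> /dF [df _]; exact/differentiable_continuous/derivable1_diffP.
rewrite integral_itv_obnd_cbnd; last first.
  by apply: measurable_funTS; exact: measurableT_comp.
rewrite (@continuous_FTC2 _ _ (fun t => - (c / (t - m)))) //.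
- by rewrite -EFinB; congr EFin; lra.
- apply: continuous_in_subspaceT => t /[!inE]/=; rewrite in_itv/= => /neq tm.
  apply: cvgM; first exact: cvg_cst.
  apply: cvgV; first by rewrite expf_neq0// subr_eq0.
  by apply: cvgM; apply: cvgB => //; exact: cvg_cst.
- split.
  + by move=> t; rewrite in_itv/= => /andP[/ltW xt /ltW ty];
      have [] := dF t; rewrite ?xt.
  + by apply: cvg_at_right_filter; apply: cF; rewrite lexx ltW.
  + by apply: cvg_at_left_filter; apply: cF; rewrite lexx ltW.
- move=> t; rewrite in_itv/= => /andP[/ltW xt /ltW ty].
  by have := dF t; rewrite xt ty => /(_ isT) [_]; rewrite derive1E.
Qed.

Lemma measurable_hyperbola (c m k : R) :
  measurable_fun setT (fun t : R => m + c / (t - k)).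
Proof.
apply: measurable_funD => //; apply: measurable_funM => //.
by apply: (measurableT_comp measurable_invr); exact: measurable_funB.
Qed.

Lemma measurable_inv_square (c m : R) :
  measurable_fun setT (fun t : R => c / (t - m) ^+ 2).
Proof.
apply: measurable_funM => //; apply: (measurableT_comp measurable_invr).
by apply: measurable_funX; exact: measurable_funB.
Qed.

(** The mass beyond [x] is [c / (x - m)]. Reading [w - p] as this mass and solving for [x] gives the
    map: it decreases from infinity at [p] to [m + K] at the other end. *)
Lemma transports_right_tail (p c m K : R) : 0 < c -> 0 < K ->
  transports `]p, p + c / K] (fun w => m + c / (w - p))
    (fun x => if m + K <= x then c / (x - m) ^+ 2 else 0).
Proof.
move=> c0 K0.
have mg : measurable_fun setT
    (fun x : R => if m + K <= x then c / (x - m) ^+ 2 else 0).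
  apply: measurable_fun_ifT => //; first exact: measurable_fun_ler.
  exact: measurable_inv_square.
have g0 x : 0 <= (if m + K <= x then c / (x - m) ^+ 2 else 0).
  by case: ifP => // _; apply: divr_ge0; [exact: ltW|exact: sqr_ge0].
apply: transports_itvoc => //.
- by rewrite lebesgue_itvoc ltry.
- exact: measurable_hyperbola.
move=> x y xy.
(* The map and its inverse [t |-> p + c / (t - m)] both reverse the order. *)
have ltE t z : p < z -> m < t -> (t < m + c / (z - p)) = (z < p + c / (t - m)).
  move=> pz mt; rewrite -ltrBlDl -[in RHS]ltrBlDl.
  by rewrite ltr_pdivlMr ?subr_gt0// ltr_pdivlMr ?subr_gt0// mulrC.
have leE t z : p < z -> m < t -> (m + c / (z - p) <= t) = (p + c / (t - m) <= z).
  by move=> pz mt; rewrite !leNgt ltE.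
have geE t z : p < z -> m < t -> (t <= m + c / (z - p)) = (z <= p + c / (t - m)).
  move=> pz mt; rewrite -lerBlDl -[in RHS]lerBlDl.
  by rewrite ler_pdivlMr ?subr_gt0// ler_pdivlMr ?subr_gt0// mulrC.
have KE : p + c / K = p + c / (m + K - m) by rewrite addrAC subrr add0r.
have mK : m < m + K by rewrite ltrDl.
(* Three positions of []x, y]]: before the tail, inside it, or across its end [m + K]. *)
have [yK|Ky] := ltP y (m + K).
  rewrite (_ : _ `&` _ = set0) ?measure0; last first.
    apply/seteqP; split=> z //=; rewrite !in_itv/= => -[/andP[pz zK] /andP[_]].
    by apply/negP; rewrite -ltNge (lt_le_trans yK)// geE// -KE.
  rewrite integral0_eq// => t /=; rewrite in_itv/= => /andP[_ ty].
  by rewrite leNgt (le_lt_trans ty yK).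
have my : m < y by exact: lt_le_trans mK Ky.
have [Kx|xK] := leP (m + K) x.
  have mx : m < x by exact: lt_le_trans mK Kx.
  (* As the map is decreasing, the preimage is closed on the left and open on the right. *)
  rewrite (_ : _ `&` _ = `[p + c / (y - m), p + c / (x - m)[%classic); last first.
    apply/seteqP; split=> z /=; rewrite !in_itv/=.
      by move=> [/andP[pz zK] /andP[xz zy]]; rewrite -ltE// xz -leE// zy.
    move=> /andP[yz zx].
    have pz : p < z by rewrite (lt_le_trans _ yz)// ltrDl divr_gt0// subr_gt0.
    rewrite pz ltE// leE// zx yz; split => //.
    rewrite (le_trans (ltW zx))// lerD2l ler_pM2l// lef_pV2 ?posrE ?subr_gt0//.
    by rewrite lerBrDl.
  rewrite lebesgue_measure_itv/= lte_fin ltrD2l ltr_pM2l// ltf_pV2 ?posrE ?subr_gt0//.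
  rewrite ltrD2r xy -EFinB.
  rewrite -[LHS](_ : (c / (x - m) - c / (y - m))%:E = _); last by congr EFin; lra.
  rewrite -integral_hyperbola ?mx ?orbT//.
  apply: eq_integral => t; rewrite inE/= in_itv/= => /andP[xt _].
  by rewrite (le_trans Kx (ltW xt)).
rewrite (_ : _ `&` _ = `[p + c / (y - m), p + c / K]%classic); last first.
  apply/seteqP; split=> z /=; rewrite !in_itv/=.
    by move=> [/andP[pz ->] /andP[xz zy]]; rewrite andbT -leE// zy.
  move=> /andP[yz zx].
  have pz : p < z by rewrite (lt_le_trans _ yz)// ltrDl divr_gt0// subr_gt0.
  rewrite pz zx leE// yz; split => //; rewrite andbT (lt_le_trans xK)//.
  by rewrite geE// -KE.
have cKy : c / (y - m) <= c / K.
  by rewrite ler_pM2l// lef_pV2 ?posrE ?subr_gt0// lerBrDl.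
transitivity (c / K - c / (y - m))%:E.
  rewrite lebesgue_measure_itv/= lte_fin ltrD2l lt_neqAle cKy andbT.
  case: eqP => [->|_]; first by rewrite subrr.
  by rewrite -EFinB; congr EFin; lra.
have xKy : `]x, y] `&` `[m + K, +oo[ = `[m + K, y]%classic.
  apply/seteqP; split => t /=; rewrite !in_itv/= andbT; first by case=> /andP[_ ->] ->.
  by move=> /andP[Kt ->]; rewrite (lt_le_trans xK Kt).
transitivity (\int[mu]_(t in `[(m + K)%R, y]) (c / (t - m) ^+ 2)%:E)%E.
  have := Ky; rewrite le_eqVlt => /predU1P[Kye|Kylt].
    by rewrite -Kye set_itv1 integral_set1 addrAC subrr add0r subrr.
  rewrite -integral_itv_obnd_cbnd; last first.
    by apply: measurable_funTS; apply: measurableT_comp => //; exact: measurable_inv_square.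
  by rewrite integral_hyperbola ?mK ?orbT// [m + K - m]addrAC subrr add0r.
rewrite -xKy integral_mkcondr; apply: eq_integral => t _.
by rewrite /patch mem_setE in_itv/= andbT; case: ifP.
Qed.

Lemma lebesgue_measure_oppr (A : set R) : measurable A ->
  mu (-%R @^-1` A) = mu A.
Proof.
move=> mA; apply/esym.
have mN : measurable_fun setT (-%R : R -> R) by exact: oppr_measurable.
pose N : {mfun (measurableTypeR R) >-> (measurableTypeR R)} := HB.pack (-%R : R -> R)
  (isMeasurableFun.Build _ _ (measurableTypeR R) (measurableTypeR R) _ mN).
have := @lebesgue_measure_unique R (pushforward mu N); apply => //.
move=> _ [[x y] _ <-] /=; rewrite /pushforward.
rewrite (_ : N @^-1` _ = `[- y, - x[%classic); last first.
  by apply/seteqP; split=> z /=; rewrite !in_itv/= lerNl ltrNr andbC.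
rewrite lebesgue_measure_itv lebesgue_measure_itv/= !lte_fin ltrN2.
by case: ifP => // _; rewrite -!EFinB; congr EFin; lra.
Qed.

Lemma transports_oppr (D : set R) (psi g : R -> R) : measurable_fun setT g ->
  (forall x, 0 <= g x) -> transports D psi g ->
  transports D (fun w => - psi w) (fun x => g (- x)).
Proof.
move=> mg g0 H A mA.
have mN : measurable_fun setT (-%R : R -> R) by exact: oppr_measurable.
have mNA : measurable (-%R @^-1` A) by rewrite -[X in measurable X]setTI; exact: mN.
have NNA : -%R @^-1` (-%R @^-1` A) = A.
  by apply/seteqP; split => x /=; rewrite opprK.
have -> : D `&` (fun w => - psi w) @^-1` A = D `&` psi @^-1` (-%R @^-1` A) by [].
rewrite H//.
pose N : {mfun (measurableTypeR R) >-> (measurableTypeR R)} := HB.pack (-%R : R -> R)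
  (isMeasurableFun.Build _ _ (measurableTypeR R) (measurableTypeR R) _ mN).
transitivity (\int[pushforward mu N]_(x in -%R @^-1` A) (g x)%:E)%E.
  apply: eq_measure_integral => B mB _.
  exact/esym/lebesgue_measure_oppr.
rewrite ge0_integral_pushforward//.
- by rewrite NNA.
- by apply: measurable_funTS; exact: measurableT_comp.
- by move=> x _; rewrite lee_fin.
Qed.

(** Reflection of the right tail around [- m]. *)
Lemma transports_left_tail (p c m K : R) : 0 < c -> 0 < K ->
  transports `]p, p + c / K] (fun w => m - c / (w - p))
    (fun x => if x <= m - K then c / (x - m) ^+ 2 else 0).
Proof.
move=> c0 K0.
have := @transports_right_tail p c (- m) K c0 K0.
move=> /transports_oppr H.
have psiE : (fun w => m - c / (w - p)) = fun w => - (- m + c / (w - p)).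
  by apply/funext => w; rewrite opprD opprK.
have gE : (fun x => if x <= m - K then c / (x - m) ^+ 2 else 0) =
    fun x => if - m + K <= - x then c / (- x - - m) ^+ 2 else 0.
  apply/funext => x; rewrite -opprD sqrrN.
  by rewrite (_ : (x <= m - K) = (- m + K <= - x))//; apply/idP/idP; lra.
rewrite psiE gE; apply: H.
  apply: measurable_fun_ifT => //; first exact: measurable_fun_ler.
  exact: measurable_inv_square.
by move=> x; case: ifP => // _; apply: divr_ge0; [exact: ltW|exact: sqr_ge0].
Qed.

Lemma measurable_glue (a b : R) (phi psi : R -> R) :
  measurable_fun setT phi -> measurable_fun setT psi ->
  measurable_fun setT (fun w => if a < w <= b then psi w else phi w).
Proof.
move=> mphi mpsi; apply: measurable_fun_ifT => //.
by apply: measurable_and; [exact: measurable_fun_ltr|exact: measurable_fun_ler].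
Qed.

(** The sources are adjacent and disjoint, so the image measures add up; the supports of [g] and [h]
    may overlap. *)
Lemma transports_glue (a b c : R) (phi psi g h : R -> R) : a <= b -> b <= c ->
  measurable_fun setT phi -> measurable_fun setT psi ->
  measurable_fun setT g -> measurable_fun setT h ->
  (forall x, 0 <= g x) -> (forall x, 0 <= h x) ->
  transports `]a, b] phi g -> transports `]b, c] psi h ->
  transports `]a, c] (fun w => if b < w <= c then psi w else phi w)
    (fun x => g x + h x).
Proof.
move=> ab bc mphi mpsi mg mh g0 h0 Hphi Hpsi A mA.
have mpre (xi : R -> R) : measurable_fun setT xi -> measurable (xi @^-1` A).
  by move=> mxi; rewrite -[X in measurable X]setTI; exact: mxi.
rewrite (_ : _ `&` _ = (`]a, b] `&` phi @^-1` A) `|` (`]b, c] `&` psi @^-1` A));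
    last first.
  apply/seteqP; split => w /=; rewrite !in_itv/=.
    move=> [/andP[aw wc]]; case: ifPn => [_|+ Aw]; first by move=> Aw; right.
    by rewrite negb_and -leNgt wc orbF => wb; left; rewrite aw wb.
  move=> [[/andP[aw wb] Aw]|[/andP[bw wc] Aw]].
    by rewrite aw (le_trans wb)// ltNge wb.
  by rewrite (le_lt_trans ab bw) wc bw.
transitivity (mu (`]a, b] `&` phi @^-1` A) + mu (`]b, c] `&` psi @^-1` A))%E.
  apply: measureU.
  - by apply: measurableI => //; exact: mpre.
  - by apply: measurableI => //; exact: mpre.
  - apply/seteqP; split => w //=; rewrite !in_itv/=.
    by move=> [[/andP[_ wb] _] [/andP[bw _] _]]; move: wb; rewrite leNgt bw.
rewrite Hphi// Hpsi// -ge0_integralD//=.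
- by move=> x _; rewrite lee_fin.
- by apply: measurable_funTS; exact: measurableT_comp.
- by move=> x _; rewrite lee_fin.
- by apply: measurable_funTS; exact: measurableT_comp.
Qed.

(** The recursion follows an upward scan: one more cell overwrites the result if [w] falls in it,
    and [0] is the initial content of the result register. *)
Fixpoint inversion (C : nat -> R) (psi : nat -> R -> R) (n : nat) (w : R) : R :=
  if n is n'.+1 then
    if C n' < w <= C n'.+1 then psi n' w else inversion C psi n' w
  else 0.

Lemma measurable_inversion C psi n : (forall i, measurable_fun setT (psi i)) ->
  measurable_fun setT (inversion C psi n).
Proof.
move=> mpsi; elim: n => [|n IH] /=; first exact: measurable_cst.
exact: measurable_glue.
Qed.

Lemma transports_inversion C psi (g : nat -> R -> R) n :
  (forall i, C i <= C i.+1) ->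
  (forall i, measurable_fun setT (psi i)) ->
  (forall i, measurable_fun setT (g i)) -> (forall i x, 0 <= g i x) ->
  (forall i, transports `]C i, C i.+1] (psi i) (g i)) ->
  transports `]C 0%N, C n] (inversion C psi n) (fun x => \sum_(i < n) g i x).
Proof.
move=> CS mpsi mg g0 H; elim: n => [|n IH].
  move=> A mA; rewrite set_itv_ge ?bnd_simp ?ltxx// set0I measure0.
  by under eq_integral do rewrite big_ord0; rewrite integral0.
have C0n : C 0%N <= C n by elim: (n) => // k; move/le_trans; apply.
rewrite (_ : (fun x => _) = fun x => \sum_(i < n) g i x + g n x); last first.
  by apply/funext => x; rewrite big_ord_recr.
apply: transports_glue => //.
- exact: measurable_inversion.
- by apply: (@measurable_sum _ _ _ _ _ _ (fun (i : 'I_n) x => g i x)).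
- by move=> x; rewrite sumr_ge0.
Qed.

(** The left-open cells of variates cover only []0, 1]]; the missing point [0] is null. *)
Lemma uniform_prob_itvoc (A : set R) : measurable A ->
  uniform_prob (@ltr01 R) A = mu (`]0, 1] `&` A).
Proof.
move=> mA; rewrite /uniform_prob integral_uniform_pdf.
transitivity (\int[mu]_(x in A `&` `[0%R, 1%R]) (cst 1 x))%E.
  apply: eq_integral => x; rewrite inE/= in_itv/= => -[_ x01].
  by rewrite /uniform_pdf x01 subr0 invr1.
rewrite integral_cst ?mul1e//; last exact: measurableI.
apply/eqP; rewrite eq_le; apply/andP; split; last first.
  apply: le_measure; rewrite ?inE; [exact: measurableI|exact: measurableI|].
  by move=> x /= []; rewrite !in_itv/= => /andP[/ltW -> ->].
have sub : A `&` `[0, 1] `<=` [set 0] `|` (`]0, 1] `&` A).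
  move=> x /= [Ax]; rewrite !in_itv/= le_eqVlt => /andP[/predU1P[<-|x0 x1]]; first by left.
  by right; rewrite x0 x1.
have mI : measurable (`]0, 1] `&` A) by exact: measurableI.
have le1 : (mu (A `&` `[0%R, 1%R]) <= mu ([set 0%R] `|` (`]0%R, 1%R] `&` A)))%E.
  by apply: le_measure => //; rewrite inE; [exact: measurableI|exact: measurableU].
apply: (le_trans le1).
have le2 : (mu ([set 0%R] `|` (`]0%R, 1%R] `&` A)) <=
    mu [set 0%R] + mu (`]0%R, 1%R] `&` A))%E by exact: measureU2.
by apply: (le_trans le2); rewrite lebesgue_measure_set1 add0e.
Qed.

Lemma transports_uniform (psi g : R -> R) : measurable_fun setT psi ->
  transports `]0, 1] psi g ->
  forall A, measurable A ->
  uniform_prob (@ltr01 R) (psi @^-1` A) = (\int[mu]_(x in A) (g x)%:E)%E.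
Proof.
move=> mpsi H A mA; rewrite uniform_prob_itvoc ?H//.
by rewrite -[X in measurable X]setTI; exact: mpsi.
Qed.

End MeasureUnique.

(** * The acceptance-complement law *)

Section Rejection.
Context {R : realType}.
Local Notation mu := (@lebesgue_measure R).
Local Notation unif := (uniform_prob (@ltr01 R)).

(** Uniqueness of the product measure extends the identity from rectangles to all [D]. With [E] the
    whole space this is the joint law of two variates; with [E] an event of a third variate it is
    independence from the pair. *)
Lemma joint_law d (T : measurableType d) (P : probability T R)
    (X Y : {RV P >-> R}) (E : set T) (mE : measurable E) :
  (forall A B : set R, measurable A -> measurable B ->
     P (E `&` (X @^-1` A `&` Y @^-1` B)) = (P E * (unif A * unif B))%E) ->
  forall D : set (R * R), measurable D ->
  P (E `&` [set w | D (X w, Y w)]) = (P E * (unif \x unif)%E D)%E.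
Proof.
move=> H D mD.
have mXY : measurable_fun setT (fun w => (X w, Y w)) by exact: measurable_fun_pair.
have mpre (B : set (R * R)) : measurable B -> measurable [set w | B (X w, Y w)].
  by move=> mB; rewrite -[X in measurable X]setTI; exact: mXY.
have PE : (P E) \is a fin_num by exact: fin_num_measure.
have [PE0|PE0] := eqVneq (P E) 0%E.
  rewrite PE0 mul0e; apply/eqP; rewrite eq_le measure_ge0 andbT -PE0.
  by apply: le_measure => //; rewrite inE//; apply: measurableI => //; exact: mpre.
have p0 : 0 < fine (P E) by rewrite fine_gt0// lt_neqAle eq_sym PE0 measure_ge0 ltey_eq PE.
have ip0 : 0 <= (fine (P E))^-1 by rewrite invr_ge0 ltW.
(* After division by [P E], the conditional law of the pair agrees with the product measure on
   rectangles. *)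
have -> : (unif \x unif)%E D =
    ((fine (P E))^-1%:E * P (E `&` [set w | D (X w, Y w)]))%E.
  have := @product_measure_unique _ _ (measurableTypeR R) (measurableTypeR R) R
    unif unif (mscale (NngNum ip0)
    (@pushforward _ _ T (measurableTypeR R * measurableTypeR R)%type R
       (mrestr P mE) (fun w => (X w, Y w)))).
  move=> U; rewrite (U mXY)//=.
    by congr (_ * P _)%E; rewrite setIC.
  move=> A B mA mB.
  transitivity ((fine (P E))^-1%:E * P (E `&` (X @^-1` A `&` Y @^-1` B)))%E.
    by congr (_ * P _)%E; rewrite setIC.
  rewrite H//.
  by rewrite muleA -[P E in LHS]fineK// -EFinM mulVf ?mul1e// gt_eqF.
by rewrite muleA -[P E in RHS]fineK// -EFinM divff ?mul1e// gt_eqF.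
Qed.

Lemma uniform_prob_le (t : R) : 0 <= t <= 1 -> unif [set v | v <= t] = t%:E.
Proof.
move=> /andP[t0 t1]; rewrite uniform_prob_itvoc; last first.
  by rewrite -[X in measurable X]setTI; exact: measurable_fun_ler.
rewrite (_ : _ `&` _ = `]0, t]%classic).
  by rewrite lebesgue_itvoc subr0 max_r.
apply/seteqP; split => x /=; rewrite !in_itv/=; first by move=> [/andP[-> _]].
by move=> /andP[-> xt]; rewrite (le_trans xt).
Qed.

Lemma measurable_acceptance (phi q e : R -> R) (A : set R) :
  measurable_fun setT phi -> measurable_fun setT q -> measurable_fun setT e ->
  measurable A ->
  measurable [set uv : R * R | A (phi uv.1) /\ uv.2 * q (phi uv.1) <= e (phi uv.1)].
Proof.
move=> mphi mq me mA.
have mphi1 : measurable_fun setT (fun uv : R * R => phi uv.1).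
  by apply: measurableT_comp => //; exact: measurable_fst.
rewrite (_ : [set _ | _] = (fun uv : R * R => phi uv.1) @^-1` A `&`
  [set uv : R * R | uv.2 * q (phi uv.1) <= e (phi uv.1)])//.
apply: measurableI; first by rewrite -[X in measurable X]setTI; exact: mphi1.
rewrite -[X in measurable X]setTI; apply: measurable_fun_ler => //.
  apply: measurable_funM; first exact: measurable_snd.
  exact: measurableT_comp mq mphi1.
exact: measurableT_comp me mphi1.
Qed.

(** A candidate [y] of density [q] is kept with probability [e y / q y], so the kept candidates have
    density [e]. *)
Lemma acceptance (phi q e : R -> R) (A : set R) :
  measurable_fun setT phi -> measurable_fun setT q -> measurable_fun setT e ->
  (forall x, 0 <= e x <= q x) -> transports `]0, 1] phi q -> measurable A ->
  (unif \x unif)%E [set uv | A (phi uv.1) /\ uv.2 * q (phi uv.1) <= e (phi uv.1)]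
    = (\int[mu]_(y in A) (e y)%:E)%E.
Proof.
move=> mphi mq me eq H mA.
have mle : measurable [set yv : R * R | A yv.1 /\ yv.2 * q yv.1 <= e yv.1].
  exact: (measurable_acceptance id).
set D := [set yv : R * R | _] in mle.
have mD : measurable [set uv : R * R | D (phi uv.1, uv.2)].
  exact: (measurable_acceptance phi).
set D' := [set uv : R * R | _] in mD.
transitivity ((unif \x unif)%E D') => //.
transitivity (\int[unif \x unif]_z (\1_D' z)%:E)%E.
  by rewrite integral_indic// setIT.
have := @fubini_tonelli2 _ _ (measurableTypeR R) (measurableTypeR R) R unif unif
  (EFin \o \1_D').
move=> ->; last 2 first.
- by apply/measurable_EFinP; exact: measurable_indic.
- by move=> x /=; rewrite lee_fin.
pose F (yv : R * R) : \bar R := (q yv.1 * \1_D yv)%:E.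
have q0 y : 0 <= q y by have /andP[e0] := eq y; exact: le_trans.
(* For fixed [v], the transport hypothesis trades the variate [u] for the candidate [y]. *)
transitivity (\int[unif]_v \int[mu]_y F (y, v))%E.
  apply: eq_integral => v _; rewrite /fubini_G.
  have mDv : measurable [set y | D (y, v)].
    rewrite (_ : [set _ | _] = ysection D v); first exact: measurable_ysection.
    by apply/seteqP; split => y; rewrite /ysection/= inE.
  have mpDv : measurable (phi @^-1` [set y | D (y, v)]).
    by rewrite -[X in measurable X]setTI; exact: mphi.
  transitivity (\int[unif]_u (\1_(phi @^-1` [set y | D (y, v)]) u)%:E)%E.
    by apply: eq_integral => u _ /=; rewrite !indicE.
  transitivity (unif (phi @^-1` [set y | D (y, v)])).
    by rewrite integral_indic// setIT.
  transitivity (\int[mu]_(y in [set y | D (y, v)]) (q y)%:E)%E.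
    exact: transports_uniform.
  rewrite integral_mkcond.
  apply: eq_integral => y _.
  rewrite /F /patch indicE; case: ifPn => [/set_mem yD|/negP yD].
    by rewrite (mem_set (yD : D (y, v))) mulr1.
  by rewrite memNset ?mulr0// => Dy; apply: yD; rewrite inE.
have mF : measurable_fun setT F.
  apply/measurable_EFinP; apply: measurable_funM; last exact: measurable_indic.
  by apply: measurableT_comp => //; exact: measurable_fst.
have F0 yv : (0 <= F yv)%E by rewrite lee_fin mulr_ge0.
(* Exchanging the integrals leaves, for fixed [y], only the law of [v]. *)
have := @fubini_tonelli _ _ (measurableTypeR R) (measurableTypeR R) R mu unif F mF F0.
move=> <-.
rewrite [RHS]integral_mkcond; apply: eq_integral => y _.
rewrite /patch; case: ifPn => [/set_mem|/negP] yA; last first.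
  rewrite integral0_eq// => v _; rewrite /F indicE memNset ?mulr0//=.
  by move=> [Ay _]; apply: yA; rewrite inE.
have /andP[e0 eqy] := eq y.
(* Where [q y = 0] the quotient [e y / q y] is meaningless, but [e y = 0] too. *)
have [qy0|qy0] := eqVneq (q y) 0.
  rewrite integral0_eq; first by congr EFin; apply/eqP; rewrite eq_le e0 -qy0 eqy.
  by move=> v _; rewrite /F/= qy0 mul0r.
have qy : 0 < q y by rewrite lt_neqAle eq_sym qy0 q0.
have mlev : measurable [set v : R | v <= e y / q y].
  by rewrite -[X in measurable X]setTI; exact: measurable_fun_ler.
transitivity (\int[unif]_v ((q y)%:E * (\1_[set v : R | (v <= e y / q y)%R] v)%:E))%E.
  apply: eq_integral => v _; rewrite /F/= EFinM; congr (_ * (_ : R)%:E)%E.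
  rewrite !indicE; congr (_ : bool)%:R; apply/idP/idP; rewrite !inE/= ler_pdivlMr//.
  by case.
rewrite ge0_integralZl//.
  transitivity ((q y)%:E * unif [set v : R | (v <= e y / q y)%R])%E.
    by rewrite integral_indic// setIT.
  transitivity ((q y)%:E * (e y / q y)%:E)%E.
    congr (_ * _)%E; apply: uniform_prob_le.
    by rewrite divr_ge0// ler_pdivrMr// mul1r.
  by rewrite -EFinM mulrCA mulfV// mulr1.
- by apply/measurable_EFinP; exact: measurable_indic.
- by rewrite lee_fin.
Qed.

(** On [A], acceptance contributes the integral of [f - r]. Refusal has probability [c] and is
    followed by an independent draw of density [r / c], which contributes the integral of [r].
    Variate [0] is left for [V]. *)
Lemma acceptance_complement_law d (T : measurableType d) (P : probability T R)
    (U : nat -> {RV P >-> R}) (f q r phi psi : R -> R) (c : R) :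
  density f -> measurable_fun setT q -> measurable_fun setT r ->
  (forall x, 0 <= r x) -> (forall x, r x <= f x <= q x + r x) ->
  measurable_fun setT phi -> transports `]0, 1] phi q ->
  measurable_fun setT psi -> (\int[mu]_x (r x)%:E)%E = c%:E ->
  (0 < c -> transports `]0, 1] psi (fun x => r x / c)) ->
  iid_uniform U ->
  exists2 X : {RV P >-> R},
    (forall w, X w = if U 2%N w * q (phi (U 1%N w)) <= f (phi (U 1%N w)) - r (phi (U 1%N w))
       then phi (U 1%N w) else psi (U 3%N w)) & has_density X f.
Proof.
move=> fd mq mr r0 rfq mphi Hphi mpsi rc Hpsi [U01 HU indep].
have mf : measurable_fun setT f by case: fd.
pose e x := f x - r x.
have me : measurable_fun setT e by exact: measurable_funB.
have eq x : 0 <= e x <= q x.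
  by have /andP[lo up] := rfq x; rewrite /e; apply/andP; split; lra.
have e0 x : 0 <= e x by have /andP[] := eq x.
have c0 : 0 <= c by rewrite -lee_fin -rc; apply: integral_ge0 => x _; rewrite lee_fin.
pose acc (A : set R) := [set uv : R * R | A (phi uv.1) /\ uv.2 * q (phi uv.1) <= e (phi uv.1)].
have macc A : measurable A -> measurable (acc A) by exact: measurable_acceptance.
have PU k (A : set R) : measurable A -> P (U k @^-1` A) = unif A by exact: HU.
have mU k (A : set R) : measurable A -> measurable (U k @^-1` A).
  by move=> mA; rewrite -[X in measurable X]setTI; exact: measurable_funPT.
have mUU (D : set (R * R)) : measurable D -> measurable [set w | D (U 1%N w, U 2%N w)].
  move=> mD; rewrite -[X in measurable X]setTI.
  exact: (measurable_fun_pair (measurable_funPT (U 1%N)) (measurable_funPT (U 2%N))).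
pose X0 w := if U 2%N w * q (phi (U 1%N w)) <= e (phi (U 1%N w))
  then phi (U 1%N w) else psi (U 3%N w).
have mX0 : measurable_fun setT X0.
  have mY : measurable_fun setT (fun w => phi (U 1%N w)) by exact: measurableT_comp.
  apply: measurable_fun_ifT => //; last exact: measurableT_comp.
  apply: measurable_fun_ler; last exact: measurableT_comp me mY.
  by apply: measurable_funM => //; exact: measurableT_comp mq mY.
pose X : {RV P >-> R} := HB.pack X0 (isMeasurableFun.Build _ _ _ _ _ mX0).
exists X => // A mA.
have joint12 D : measurable D -> P [set w | D (U 1%N w, U 2%N w)] = (unif \x unif)%E D.
  move=> mD; transitivity (P (setT `&` [set w | D (U 1%N w, U 2%N w)])).
    by rewrite setTI.
  transitivity (P setT * (unif \x unif) D)%E; last by rewrite probability_setT mul1e.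
  apply: joint_law => // A1 B1 mA1 mB1; rewrite probability_setT mul1e.
  have := indep [:: 1%N; 2%N] (fun k => if k == 1%N then A1 else B1) isT.
  rewrite !big_cons big_nil/= mule1 !PU// => <-; last by move=> k; case: ifP.
  rewrite setTI; congr (P _); apply/seteqP; split => w /=.
    by move=> [Aw Bw] k; rewrite !inE => /orP[]/eqP->.
  by move=> H; split; [apply: (H 1%N)|apply: (H 2%N)]; rewrite !inE.
have accE (B : set R) : measurable B ->
    P [set w | acc B (U 1%N w, U 2%N w)] = (\int[mu]_(y in B) (e y)%:E)%E.
  move=> mB; rewrite joint12; last exact: macc.
  exact: (acceptance phi q e B mphi mq me eq Hphi mB).
have mrej : measurable (~` acc setT) by apply: measurableC; exact: macc.
have el : (\int[mu]_x (e x)%:E + \int[mu]_x (r x)%:E = 1)%E.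
  rewrite -ge0_integralD//=.
  - case: fd => _ _ <-; apply: eq_integral => x _.
    by rewrite -EFinD /e subrK.
  - by move=> x _; rewrite lee_fin.
  - exact: measurableT_comp.
  - by move=> x _; rewrite lee_fin r0.
  - by apply/measurable_EFinP; exact: mr.
(* This is where the total mass of [f] being [1] is decisive: the refusal probability equals the
   mass of [r]. *)
have rejE : P [set w | (~` acc setT) (U 1%N w, U 2%N w)] = (c)%:E.
  have -> : [set w | (~` acc setT) (U 1%N w, U 2%N w)] =
      ~` [set w | acc setT (U 1%N w, U 2%N w)] by [].
  rewrite probability_setC; last by apply: mUU; exact: macc.
  rewrite accE// -[in LHS]el rc addeAC subee ?add0e//.
  move: el; rewrite rc; case: (\int[mu]_x _)%E => //.
pose E := U 3%N @^-1` (psi @^-1` A).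
have mLA : measurable (psi @^-1` A).
  by rewrite -[X in measurable X]setTI; exact: mpsi.
have mE : measurable E by exact: mU.
have rejAE : P (E `&` [set w | (~` acc setT) (U 1%N w, U 2%N w)]) =
    (\int[mu]_(x in A) (r x)%:E)%E.
  transitivity (P E * (c)%:E)%E.
    rewrite -rejE joint12//; apply: joint_law => // A1 B1 mA1 mB1.
    have := indep [:: 3%N; 1%N; 2%N] (fun k => if k == 3%N then psi @^-1` A
      else if k == 1%N then A1 else B1) isT.
    rewrite !big_cons big_nil/= mule1 /E !PU// => <-; last by move=> k; case: ifP => // _; case: ifP.
    congr (P _); apply/seteqP; split => w /=.
      by move=> [Ew [Aw Bw]] k; rewrite !inE => /or3P[]/eqP->.
    by move=> H; split; [apply: (H 3%N)|split; [apply: (H 1%N)|apply: (H 2%N)]]; rewrite !inE.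
  (* For [c = 0] nothing is known about the law of [psi], but both sides vanish. *)
  have [S0|S0] := eqVneq (c) 0.
    rewrite S0 mule0; apply/esym/eqP; rewrite eq_le integral_ge0 ?andbT; last first.
      by move=> x _; rewrite lee_fin r0.
    have r00 : (\int[mu]_x (r x)%:E)%E = 0%E by rewrite rc S0.
    rewrite -[leRHS]r00; apply: ge0_subset_integral => //.
      by apply/measurable_EFinP; exact: mr.
    by move=> x _; rewrite lee_fin r0.
  have Sgt0 : 0 < c by rewrite lt_neqAle eq_sym S0 c0.
  rewrite /E PU//.
  transitivity (\int[mu]_(x in A) (r x / c)%:E * (c)%:E)%E.
    congr (_ * _)%E; apply: (transports_uniform _ _ mpsi) => //.
    exact: Hpsi.
  rewrite muleC -ge0_integralZl//=.
  - by apply: eq_integral => x _; rewrite -EFinM mulrC divfK.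
  - by apply/measurable_EFinP/measurable_funTS; exact: measurable_funM.
  - by move=> x _; rewrite lee_fin divr_ge0// ?r0// ltW.
transitivity (P ([set w | acc A (U 1%N w, U 2%N w)] `|`
    (E `&` [set w | (~` acc setT) (U 1%N w, U 2%N w)]))).
  congr (P _); apply/seteqP; split => w /=; rewrite /X/= /X0.
    by case: ifP => [le_qe Aw|/negbT gt_qe Aw]; [left|right; split => // -[_ /(negP gt_qe)]].
  by move=> [[Aw ->//]|[Ew nacc]]; rewrite ifF//; apply/negP => le_qe; apply: nacc.
transitivity (P [set w | acc A (U 1%N w, U 2%N w)] +
    P (E `&` [set w | (~` acc setT) (U 1%N w, U 2%N w)]))%E.
  apply: measureU.
  - by apply: mUU; exact: macc.
  - by apply: measurableI => //; exact: mUU.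
  - by apply/seteqP; split => w //= -[[Aw le_qe] [_ nacc]]; apply: nacc.
rewrite accE// rejAE -ge0_integralD//=.
- by apply: eq_integral => x _; rewrite -EFinD /e subrK.
- by move=> x _; rewrite lee_fin.
- by apply/measurable_EFinP/measurable_funTS.
- by move=> x _; rewrite lee_fin r0.
- by apply/measurable_EFinP/measurable_funTS; exact: mr.
Qed.

End Rejection.

(** * Log-concave densities *)

Section LogConcave.
Context {R : realType}.
Local Notation mu := (@lebesgue_measure R).
Context {f : R -> R} {m : R}.
Hypotheses (fd : density f) (flc : log_concave f) (fm : mode f m).

Let f0 x : 0 <= f x. Proof. by case: fd. Qed.
Let mf : measurable_fun setT f. Proof. by case: fd. Qed.

Lemma le_mode x : f x <= f m.
Proof.
rewrite -lee_fin fm; apply: ereal_sup_ubound; by exists x.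
Qed.

Lemma mode_gt0 : 0 < f m.
Proof.
rewrite lt_neqAle f0 andbT eq_sym; apply/eqP => fm0.
have [_ _] := fd; rewrite integral0_eq; first by move/eqP; rewrite eq_sym onee_eq0.
by move=> x _; congr EFin; apply/eqP; rewrite eq_le f0 -fm0 le_mode.
Qed.

(** A convex combination of [ln (f x)] and the larger [ln (f m)] is at least [ln (f x)]. *)
Lemma unimodal t x : 0 <= t <= 1 -> f x <= f (t * x + (1 - t) * m).
Proof.
move=> t01; have := flc x m t t01.
have [fx0 _|fx0] := leP (f x) 0; first exact: le_trans fx0 (f0 _).
rewrite [lne (f x)%:E]lne_EFin// [lne (f m)%:E]lne_EFin ?mode_gt0//.
set z := f (_ + _) => H.
(* Otherwise the right side of [H] is [-oo] while the left side is finite. *)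
have z0 : 0 < z.
  rewrite ltNge; apply/negP => z0; move: H; rewrite [X in (_ <= X)%E]le0_lneNy ?lee_fin//.
move: H; rewrite lne_EFin// lee_fin => H.
rewrite -ler_ln ?posrE//; apply: le_trans H.
have : ln (f x) <= ln (f m) by rewrite ler_ln ?posrE ?mode_gt0// le_mode.
have /andP[t0 t1] := t01.
have : 0 <= 1 - t by lra.
nra.
Qed.

Lemma unimodal_right x y : m <= x -> x <= y -> f y <= f x.
Proof.
move=> mx xy.
have [xm|xm] := eqVneq x m; first by rewrite xm le_mode.
have {xm}mx : m < x by rewrite lt_neqAle eq_sym xm mx.
have ym : 0 < y - m by rewrite subr_gt0 (lt_le_trans mx).
have := @unimodal ((x - m) / (y - m)) y.
have -> : (x - m) / (y - m) * y + (1 - (x - m) / (y - m)) * m = x.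
  by field; rewrite gt_eqF.
by apply; apply/andP; split; [apply: divr_ge0; lra|rewrite ler_pdivrMr//; lra].
Qed.

Lemma unimodal_left x y : x <= m -> y <= x -> f y <= f x.
Proof.
move=> mx xy.
have [xm|xm] := eqVneq x m; first by rewrite xm le_mode.
have {xm}mx : x < m by rewrite lt_neqAle xm mx.
have ym : 0 < m - y by rewrite subr_gt0 (le_lt_trans xy).
have := @unimodal ((m - x) / (m - y)) y.
have -> : (m - x) / (m - y) * y + (1 - (m - x) / (m - y)) * m = x.
  by field; rewrite gt_eqF.
by apply; apply/andP; split; [apply: divr_ge0; lra|rewrite ler_pdivrMr//; lra].
Qed.

Lemma midpoint x : f x * f m <= f ((x + m) / 2) ^+ 2.
Proof.
have h01 : 0 <= (2^-1 : R) <= 1 by lra.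
have := flc x m 2^-1 h01.
have -> : 2^-1 * x + (1 - 2^-1) * m = (x + m) / 2 by field.
have [fx0 _|fx0] := leP (f x) 0.
  by apply: le_trans (sqr_ge0 _); rewrite mulr_le0_ge0.
rewrite [lne (f x)%:E]lne_EFin// [lne (f m)%:E]lne_EFin ?mode_gt0//.
set z := f (_ / _) => H.
have z0 : 0 < z.
  rewrite ltNge; apply/negP => z0; move: H; rewrite [X in (_ <= X)%E]le0_lneNy ?lee_fin//.
move: H; rewrite lne_EFin// lee_fin => H.
rewrite -ler_ln ?posrE ?mulr_gt0 ?exprn_gt0 ?mode_gt0// lnM ?posrE ?mode_gt0//.
rewrite lnXn// mulr2n; lra.
Qed.

(** A rectangle under the graph has area at most the total mass. *)
Lemma mass_le (a b h : R) : a <= b -> (forall x, a <= x <= b -> h <= f x) ->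
  h * (b - a) <= 1.
Proof.
move=> ab hf.
have [h0|h0] := leP h 0; first by apply: le_trans ler01; rewrite mulr_le0_ge0// subr_ge0.
have [_ _ f1] := fd.
rewrite -lee_fin -f1.
apply: (@le_trans _ _ (\int[mu]_(x in `[a, b]) (cst h%:E x))%E).
  rewrite integral_cst//= lebesgue_measure_itv/= lte_fin.
  case: ifPn => [_|]; first by rewrite -EFinB -EFinM.
  rewrite -leNgt => ba; have -> : b = a by apply/eqP; rewrite eq_le ba ab.
  by rewrite subrr mulr0 mule0.
apply: (@le_trans _ _ (\int[mu]_(x in `[a, b]) (f x)%:E)%E).
  apply: ge0_le_integral => //.
  - by move=> x _; rewrite lee_fin ltW.
  - by apply: measurable_funTS; exact: measurableT_comp.
apply: ge0_subset_integral => //.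
- exact: measurableT_comp.
- by move=> x _; rewrite lee_fin.
Qed.

(* For the midpoint [z] of [m] and [x], [f x * f m <= f z ^+ 2], and [f z] is at
   most the inverse of its distance to [m], since [f >= f z] between them. *)
Lemma tail_bound x : x != m -> f x <= 4 / f m / (x - m) ^+ 2.
Proof.
move=> xm; have M0 := mode_gt0; have z0 := f0 ((x + m) / 2).
set z := (x + m) / 2 in z0 *.
have fz : f z * `|x - m| <= 2.
  have [xm0|xm0] := leP x m.
    have := @mass_le z m (f z) _ _; rewrite /z => H.
    have : f z * (m - z) <= 1.
      apply: H; first by lra.
      by move=> y /andP[zy ym]; apply: unimodal_left.
    rewrite ler0_norm; last by lra.
    by rewrite /z; lra.
  have := @mass_le m z (f z) _ _; rewrite /z => H.
  have : f z * (z - m) <= 1.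
    apply: H; first by lra.
    by move=> y /andP[zy ym]; apply: unimodal_right.
  rewrite gtr0_norm; last by lra.
  by rewrite /z; lra.
have d0 : 0 < (x - m) ^+ 2 by rewrite exprn_even_gt0//= subr_eq0.
rewrite ler_pdivlMr// ler_pdivlMr// mulrAC.
apply: (@le_trans _ _ ((f z * `|x - m|) ^+ 2)).
  by rewrite exprMn real_normK ?num_real// ler_pM2r// midpoint.
have : 0 <= f z * `|x - m| by rewrite mulr_ge0.
move: (f z * _) fz => s; nra.
Qed.

End LogConcave.

(** * The envelope *)

Section Envelope.
Context {R : realType} (f : R -> R) (m : R).
Local Notation mu := (@lebesgue_measure R).

Definition width : R := 1 / (4 * f m).

Definition node (i : nat) : R := m - 64 * width + i%:R * width.

Definition cell (i : nat) : set R := `]node i, node i.+1]%classic.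

(* The value at the two extreme nodes is replaced by [0]: the gaps then sum to
   exactly [2 * f m] whatever [f] is, so the upper part has total mass [1]. *)
Definition value (i : nat) : R :=
  if (i == 0)%N || (128 <= i)%N then 0 else f (node i).

Definition low (i : nat) : R :=
  if value i <= value i.+1 then value i else value i.+1.

Definition gap (i : nat) : R :=
  if value i <= value i.+1 then value i.+1 - value i else value i - value i.+1.

Definition steps (h : nat -> R) (x : R) : R := \sum_(i < 128) h i * \1_(cell i) x.

(** Comparing squares tests the distance to [m] without an absolute value, in operations that the
    machine has. *)
Definition tail (x : R) : R :=
  if (16 / f m) * (16 / f m) <= (x - m) * (x - m)
  then 4 / f m / ((x - m) * (x - m)) else 0.

Definition lower : R -> R := steps low.

Definition upper (x : R) : R := steps gap x + tail x.

(** The distribution function at node [i] of the step function normalised by [S]: [S] is [1] for [q]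
    and [low_mass] for [r]. *)
Definition cell_mass (h : nat -> R) (S : R) (i : nat) : R :=
  \sum_(k < i) h k * width / S.

Definition cell_inv (h : nat -> R) (S : R) (i : nat) (w : R) : R :=
  node i + (w - cell_mass h S i) * S / h i.

Definition steps_inv (h : nat -> R) (S : R) : R -> R :=
  inversion (cell_mass h S) (cell_inv h S) 128.

Definition low_mass : R := \sum_(i < 128) low i * width.

Definition lower_inv : R -> R := steps_inv low low_mass.

(** The steps take the variates up to [1/2], the left tail the next quarter, the right tail the
    last. Working with the remainders [w1] and [w2] matches the register from which the program
    subtracts. *)
Definition upper_inv (w : R) : R :=
  let w1 := w - cell_mass gap 1 128 in
  let w2 := w1 - 1 / 4 in
  if 0 < w2 <= 1 / 4 then m + 4 / f m / w2 else
  if 0 < w1 <= 1 / 4 then m - 4 / f m / w1 else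
  steps_inv gap 1 w.

Lemma measurable_cell i : measurable (cell i).
Proof. exact: measurable_itv. Qed.

Lemma measurable_steps h : measurable_fun setT (steps h).
Proof.
apply: (@measurable_sum _ _ _ _ _ _ (fun (i : 'I_128) x => h i * \1_(cell i) x)).
move=> i; apply: measurable_funM => //. apply: measurable_indic. exact: measurable_cell.
Qed.

Lemma measurable_tail : measurable_fun setT tail.
Proof.
have mB : measurable_fun setT (fun x : R => (x - m) * (x - m)).
  by apply: measurable_funM; exact: measurable_funB.
apply: measurable_fun_ifT => //.
  by apply: measurable_fun_ler; [exact: measurable_cst|exact: mB].
by apply: measurable_funM => //; exact: (measurableT_comp measurable_invr mB).
Qed.

Lemma measurable_lower : measurable_fun setT lower.
Proof. exact: measurable_steps. Qed.

Lemma measurable_upper : measurable_fun setT upper.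
Proof. exact: measurable_funD (measurable_steps gap) measurable_tail. Qed.

Lemma measurable_cell_inv h S i : measurable_fun setT (cell_inv h S i).
Proof.
apply: measurable_funD => //; do 2 apply: measurable_funM => //.
exact: measurable_funB.
Qed.

Lemma measurable_steps_inv h S : measurable_fun setT (steps_inv h S).
Proof. by apply: measurable_inversion => i; exact: measurable_cell_inv. Qed.

Lemma measurable_lower_inv : measurable_fun setT lower_inv.
Proof. exact: measurable_steps_inv. Qed.

Lemma measurable_upper_inv : measurable_fun setT upper_inv.
Proof.
have m1 : measurable_fun setT (fun w : R => w - cell_mass gap 1 128).
  exact: measurable_funB.
have m2 : measurable_fun setT (fun w : R => w - cell_mass gap 1 128 - 1 / 4).
  exact: measurable_funB.
have mI (g : R -> R) : measurable_fun setT g ->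
    measurable_fun setT (fun w : R => 0 < g w <= 1 / 4).
  by move=> mg; apply: measurable_and; [exact: measurable_fun_ltr|exact: measurable_fun_ler].
have mV (g : R -> R) : measurable_fun setT g ->
    measurable_fun setT (fun w : R => 4 / f m / g w).
  by move=> mg; apply: measurable_funM => //; exact: (measurableT_comp measurable_invr mg).
apply: measurable_fun_ifT; first exact: mI m2.
  by apply: measurable_funD => //; exact: mV m2.
apply: measurable_fun_ifT; [exact: mI m1| |exact: measurable_steps_inv].
by apply: measurable_funB => //; exact: mV m1.
Qed.

Lemma nodeS i : node i.+1 = node i + width.
Proof. by rewrite /node (_ : i.+1%:R = i%:R + 1 :> R) ?natr1//; ring. Qed.

Lemma node64 : node 64 = m.
Proof. by rewrite /node subrK. Qed.

End Envelope.

(** * Domination of the density and inversion of the envelope *)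

Section EnvelopeTheory.
Context {R : realType} {f : R -> R} {m : R}.
Local Notation mu := (@lebesgue_measure R).
Hypotheses (fd : density f) (flc : log_concave f) (fm : mode f m).
Local Notation width := (width f m).
Local Notation node := (node f m).
Local Notation value := (value f m).
Local Notation low := (low f m).
Local Notation gap := (gap f m).
Local Notation cell := (cell f m).
Local Notation steps := (steps f m).
Local Notation tail := (tail f m).
Local Notation cell_mass := (cell_mass f m).
Local Notation cell_inv := (cell_inv f m).

Let f0 x : 0 <= f x. Proof. by case: fd. Qed.
Let M0 : 0 < f m := mode_gt0 fd fm.

Lemma width_gt0 : 0 < width.
Proof. by rewrite divr_gt0// mulr_gt0. Qed.

Lemma node_le i j : (i <= j)%N -> node i <= node j.
Proof.
by move=> ij; rewrite lerD2l ler_pM2r ?width_gt0// ler_nat.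
Qed.

Lemma node_le_mode i : (i <= 64)%N -> node i <= m.
Proof. by move/node_le; rewrite node64. Qed.

Lemma mode_le_node i : (64 <= i)%N -> m <= node i.
Proof. by move/node_le; rewrite node64. Qed.

Lemma value_ge0 i : 0 <= value i.
Proof. by rewrite /value; case: ifP. Qed.

Lemma low_ge0 i : 0 <= low i.
Proof. by rewrite /low; case: ifP => _; exact: value_ge0. Qed.

Lemma gap_ge0 i : 0 <= gap i.
Proof.
rewrite /gap; case: ifPn => [|]; first by rewrite subr_ge0.
by rewrite -ltNge => /ltW; rewrite subr_ge0.
Qed.

Lemma value_nondecreasing i : (i < 64)%N -> value i <= value i.+1.
Proof.
move=> i64; rewrite {1}/value; case: ifPn => [_|]; first exact: value_ge0.
rewrite negb_or => /andP[i0 _]; rewrite /value ifF; last by lia.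
by apply: (unimodal_left fd flc fm); [exact: node_le_mode|exact: node_le].
Qed.

Lemma value_nonincreasing i : (64 <= i)%N -> value i.+1 <= value i.
Proof.
move=> i64; rewrite {1}/value; case: ifPn => [_|]; first exact: value_ge0.
rewrite negb_or -ltnNge => /andP[_ i128]; rewrite /value ifF; last by lia.
by apply: (unimodal_right fd flc fm); [exact: mode_le_node|exact: node_le].
Qed.

Lemma gap_sum : \sum_(i < 128) gap i = 2 * f m.
Proof.
(* Node [64] is the mode: the values rise from [0] to [f m] before it and fall back to [0] after
   it. *)
rewrite -(big_mkord xpredT gap) (@big_cat_nat _ _ _ 64)//=.
rewrite (eq_big_nat _ _ (F2 := fun i => value i.+1 - value i)); last first.
  by move=> i /andP[_ i64]; rewrite /gap value_nondecreasing.
rewrite [X in _ + X](eq_big_nat _ _ (F2 := fun i => - value i.+1 - - value i)); last first.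
  move=> i /andP[i64 _]; have := value_nonincreasing i i64; rewrite /gap opprK [RHS]addrC.
  rewrite le_eqVlt => /predU1P[->|]; first by rewrite lexx.
  by rewrite ltNge => /negbTE ->.
rewrite (telescope_sumr value)// (telescope_sumr (fun i => - value i))//.
rewrite /value/= node64; lra.
Qed.

Lemma cellP n x : node 0 < x -> x <= node n -> exists2 i, (i < n)%N & cell i x.
Proof.
elim: n => [x0 /(lt_le_trans x0)|n IH x0 xn]; first by rewrite ltxx.
have [xn'|nx] := leP x (node n).
  by have [i ilt ci] := IH x0 xn'; exists i => //; exact: ltnW.
by exists n => //; rewrite /cell/= in_itv/= nx xn.
Qed.

Lemma steps_cell h i x : (i < 128)%N -> cell i x -> steps h x = h i.
Proof.
move=> ilt xi; rewrite /steps (bigD1 (Ordinal ilt))//= indicE mem_set// mulr1.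
rewrite big1 ?addr0// => j ji; rewrite indicE memNset ?mulr0//.
move: xi; rewrite /cell/= !in_itv/= => /andP[ix xi] /andP[jx xj].
have [ij|ji'|ij] := ltngtP i j.
- by have := node_le _ _ ij; rewrite leNgt (lt_le_trans jx).
- by have := node_le _ _ ji'; rewrite leNgt (lt_le_trans ix).
- by move/eqP: ji; apply; apply/val_inj; rewrite /= ij.
Qed.

Lemma steps_ge0 h x : (forall i, 0 <= h i) -> 0 <= steps h x.
Proof. by move=> h0; apply: sumr_ge0 => i _; rewrite mulr_ge0. Qed.

Lemma tail_ge0 x : 0 <= tail x.
Proof.
rewrite /tail; case: ifP => // _; rewrite -expr2.
by rewrite divr_ge0 ?sqr_ge0// divr_ge0// ltW.
Qed.

(** Compare with the end farther from [m]; if it is an extreme node, its value [0] makes the bound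
    trivial. *)
Lemma low_le i x : (i < 128)%N -> cell i x -> low i <= f x.
Proof.
rewrite /cell/= in_itv/= => i128 /andP[/ltW ix xi].
have lowl : low i <= value i by rewrite /low; case: ifPn; rewrite -?ltNge; lra.
have lowr : low i <= value i.+1 by rewrite /low; case: ifPn; rewrite -?ltNge; lra.
have [i64|i64] := ltnP i 64.
  apply: le_trans lowl _; rewrite /value; case: ifP => // _.
  apply: (unimodal_left fd flc fm) => //.
  by rewrite (le_trans xi)// node_le_mode.
apply: le_trans lowr _; rewrite /value; case: ifP => // _.
apply: (unimodal_right fd flc fm) => //.
by apply: le_trans ix; exact: mode_le_node.
Qed.

(** The right side is the larger of the two end values. The end nearer to [m] is never an extreme
    node, so its value is a true value of [f]. *)
Lemma le_gap_low i x : (i < 128)%N -> cell i x -> f x <= gap i + low i.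
Proof.
rewrite /cell/= in_itv/= => i128 /andP[/ltW ix xi].
have lowl : value i <= gap i + low i by rewrite /low /gap; case: ifPn; rewrite -?ltNge; lra.
have lowr : value i.+1 <= gap i + low i by rewrite /low /gap; case: ifPn; rewrite -?ltNge; lra.
have [i64|i64] := ltnP i 64.
  apply: le_trans lowr; rewrite /value ifF; last by lia.
  by apply: (unimodal_left fd flc fm) => //; exact: node_le_mode.
apply: le_trans lowl; rewrite /value ifF; last by lia.
by apply: (unimodal_right fd flc fm) => //; exact: mode_le_node.
Qed.

(** The left-open cells miss the point [node 0]; the non-strict test in [tail] covers it. *)
Lemma tail_outside x : ~~ (node 0 < x <= node 128) -> f x <= tail x.
Proof.
have KE : 64 * width = 16 / f m by rewrite /width; field; rewrite gt_eqF.
have K0 : 0 < 16 / f m by rewrite divr_gt0.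
rewrite negb_and -!leNgt -ltNge /node mul0r addr0 => xout.
have far : 16 / f m <= `|x - m|.
  move: xout => /orP[xl|xr]; rewrite -KE in K0 *.
    by rewrite ler0_norm; lra.
  by rewrite gtr0_norm; lra.
have xm : x != m.
  by apply: contraTneq far => ->; rewrite subrr normr0 -ltNge.
rewrite /tail ifT.
  by have := tail_bound fd flc fm x xm; rewrite expr2.
rewrite -!expr2 -[leRHS]real_normK ?num_real//.
by rewrite lerXn2r ?nnegrE ?(ltW K0).
Qed.

Lemma lower_upper x : lower f m x <= f x <= upper f m x + lower f m x.
Proof.
have [/andP[x0 xn]|out] := boolP (node 0 < x <= node 128).
  have [i i128 xi] := cellP 128 x x0 xn.
  rewrite /lower /upper !(steps_cell _ _ _ i128 xi) low_le//=.
  by rewrite (le_trans (le_gap_low _ _ i128 xi))// addrAC lerDl tail_ge0.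
have lowx0 : lower f m x = 0.
  rewrite /lower /steps big1// => i _; rewrite indicE memNset ?mulr0//.
  rewrite /cell/= in_itv/= => /andP[ix xi]; move/negP: out; apply.
  by rewrite (le_lt_trans _ ix) ?(le_trans xi)// node_le.
rewrite lowx0 f0 addr0/= (le_trans (tail_outside _ out))// lerDr.
by rewrite steps_ge0//; exact: gap_ge0.
Qed.

(** [S] is arbitrary: besides the two normalised samplers, the case [S = 1] yields the integral of
    [lower]. *)
Lemma transports_steps h S : 0 < S -> (forall i, 0 <= h i) ->
  transports `]0, cell_mass h S 128] (steps_inv f m h S) (fun x => steps h x / S).
Proof.
move=> S0 h0.
have := @transports_inversion R (cell_mass h S) (cell_inv h S)
  (fun i x => h i / S * \1_(cell i) x) 128.
have -> : cell_mass h S 0 = 0 by rewrite /cell_mass big_ord0.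
move=> H.
rewrite (_ : (fun x => _) = fun x => \sum_(i < 128) h i / S * \1_(cell i) x); last first.
  by apply/funext => x; rewrite /steps mulr_suml; apply: eq_bigr => i _; rewrite mulrAC.
have hS i : 0 <= h i / S by rewrite divr_ge0// ltW.
have massS i : cell_mass h S i.+1 = cell_mass h S i + h i / S * width.
  by rewrite /cell_mass big_ord_recr/= mulrAC.
apply: H => [i|i|i|i x|i].
- by rewrite massS lerDl mulr_ge0// ltW// width_gt0.
- exact: measurable_cell_inv.
- apply: measurable_funM => //; apply: measurable_indic; exact: measurable_cell.
- by rewrite mulr_ge0.
- rewrite massS (_ : cell_inv h S i = fun w => node i + (w - cell_mass h S i) / (h i / S)).
    rewrite /cell nodeS; exact: transports_cell.
  by apply/funext => w; rewrite invf_div mulrA.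
Qed.

Lemma cell_mass_gap : cell_mass gap 1 128 = 1 / 2.
Proof.
rewrite /cell_mass.
under eq_bigr do rewrite divr1.
by rewrite -mulr_suml gap_sum /width; field; rewrite gt_eqF.
Qed.

Lemma cell_mass_low : low_mass f m != 0 -> cell_mass low (low_mass f m) 128 = 1.
Proof. by move=> S0; rewrite /cell_mass -mulr_suml divff. Qed.

Lemma transports_lower : 0 < low_mass f m ->
  transports `]0, 1] (lower_inv f m) (fun x => lower f m x / low_mass f m).
Proof.
move=> S0; rewrite -cell_mass_low ?gt_eqF//.
by apply: transports_steps => //; exact: low_ge0.
Qed.

Lemma transports_upper : transports `]0, 1] (upper_inv f m) (upper f m).
Proof.
have c0 : 0 < 4 / f m by rewrite divr_gt0.
have K0 : 0 < 16 / f m by rewrite divr_gt0.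
have cK : 4 / f m / (16 / f m) = 1 / 4 by field; rewrite gt_eqF.
have Hs := transports_steps gap 1 ltr01 gap_ge0.
(* Each tail has mass [(4 / f m) / (16 / f m) = 1/4], whence the offsets [1/2] and [3/4]. *)
have Hl := transports_left_tail (1 / 2) _ m _ c0 K0.
have Hr := transports_right_tail (3 / 4) _ m _ c0 K0.
rewrite cell_mass_gap in Hs; rewrite !cK in Hl Hr.
have e34 : 1 / 2 + 1 / 4 = 3 / 4 :> R by field.
have e1 : 3 / 4 + 1 / 4 = 1 :> R by field.
rewrite e34 in Hl; rewrite e1 in Hr.
have mt (b : R -> bool) : measurable_fun setT b ->
    measurable_fun setT (fun x : R => if b x then 4 / f m / (x - m) ^+ 2 else 0).
  by move=> mb; apply: measurable_fun_ifT => //; exact: measurable_inv_square.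
have t0 (b : R -> bool) x : 0 <= if b x then 4 / f m / (x - m) ^+ 2 else 0.
  by case: ifP => // _; rewrite divr_ge0 ?sqr_ge0// ltW.
have mL : measurable_fun setT (fun x : R => x <= m - 16 / f m) by exact: measurable_fun_ler.
have mR : measurable_fun setT (fun x : R => m + 16 / f m <= x) by exact: measurable_fun_ler.
have ms : measurable_fun setT (fun x => steps gap x / 1).
  by apply: measurable_funM => //; exact: measurable_steps.
have s0 x : 0 <= steps gap x / 1 by rewrite divr1 steps_ge0//; exact: gap_ge0.
have mV c p : measurable_fun setT (fun w : R => m - c / (w - p)).
  apply: measurable_funB => //; apply: measurable_funM => //.
  by apply: (measurableT_comp measurable_invr); exact: measurable_funB.
have -> : upper_inv f m = fun w : R =>
    if 3 / 4 < w <= 1 then m + 4 / f m / (w - 3 / 4)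
    else if 1 / 2 < w <= 3 / 4 then m - 4 / f m / (w - 1 / 2) else steps_inv f m gap 1 w.
  apply/funext => w; rewrite /upper_inv cell_mass_gap.
  rewrite (_ : w - 1 / 2 - 1 / 4 = w - 3 / 4); last by field.
  rewrite !subr_gt0 !lerBlDr (_ : 1 / 4 + 3 / 4 = 1); last by field.
  by rewrite (_ : 1 / 4 + 1 / 2 = 3 / 4)//; field.
have -> : upper f m = fun x => steps gap x / 1 +
    (if x <= m - 16 / f m then 4 / f m / (x - m) ^+ 2 else 0) +
    (if m + 16 / f m <= x then 4 / f m / (x - m) ^+ 2 else 0).
  apply/funext => x; rewrite /upper divr1 -addrA; congr (_ + _).
  rewrite /tail -!expr2.
  have -> : ((16 / f m) ^+ 2 <= (x - m) ^+ 2) = (x <= m - 16 / f m) || (m + 16 / f m <= x).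
    rewrite -[(x - m) ^+ 2]real_normK ?num_real// ler_pXn2r ?nnegrE ?(ltW K0)//.
    by rewrite ler_normr orbC; congr (_ || _); apply/idP/idP; lra.
  (* The two tails are disjoint because [16 / f m > 0]. *)
  case: (boolP (x <= m - 16 / f m)) => xl /=; last by rewrite add0r.
  by rewrite ifF ?addr0//; apply/negbTE; rewrite -ltNge; lra.
apply: transports_glue; [lra|lra| | | | | | | |exact: Hr].
- by apply: measurable_glue; [exact: measurable_steps_inv|exact: mV].
- exact: measurable_hyperbola.
- by apply: measurable_funD; [exact: ms|exact: (mt _ mL)].
- exact: (mt _ mR).
- by move=> x; rewrite addr_ge0// (t0 (fun x => x <= m - 16 / f m)).
- exact: (t0 (fun x => m + 16 / f m <= x)).
apply: transports_glue; [lra|lra| | | | | | |exact: Hs|exact: Hl].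
- exact: measurable_steps_inv.
- exact: mV.
- exact: ms.
- exact: (mt _ mL).
- exact: s0.
- exact: (t0 (fun x => x <= m - 16 / f m)).
Qed.

End EnvelopeTheory.

(** * The programs *)

(* Scratch registers, in order: remaining part of the variate, normalising constant,
   index, mode height, cell width, left node and value, right node and value,
   height, mass, zero, temporary, result. *)
Notation rW := 10%N (only parsing).
Notation rS := 11%N (only parsing).
Notation rJ := 12%N (only parsing).
Notation rH := 13%N (only parsing).
Notation rD := 14%N (only parsing).
Notation rNl := 15%N (only parsing).
Notation rVl := 16%N (only parsing).
Notation rNr := 17%N (only parsing).
Notation rVr := 18%N (only parsing).
Notation rG := 19%N (only parsing).
Notation rC := 20%N (only parsing).
Notation rZ := 21%N (only parsing).
Notation rA := 22%N (only parsing).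
Notation rE := 23%N (only parsing).
Notation rB := 24%N (only parsing).

(** Scratch registers may hold anything when a routine starts, so the whole state of the scan is
    rebuilt from [m]. *)
Definition prelude : prog :=
  [:: Query rH rM; Const rD 4; Arith Mul rD rD rH; Const rNl 1;
      Arith Div rD rNl rD; Const rJ 0; Const rNl 64; Arith Mul rNl rNl rD;
      Arith Defs.Sub rNl rM rNl; Const rVl 0; Const rZ 0; Const rE 0].

(** Only the last node needs a test: the value [0] at node [0] is set by [prelude]. *)
Definition advance : prog :=
  [:: Const rA 1; Arith Add rJ rJ rA; Arith Add rNr rNl rD; Const rA 128;
      If rA rJ [:: Const rVr 0] [:: Query rVr rNr]].

Definition low_code : prog := [:: If rVl rVr [:: Copy rG rVl] [:: Copy rG rVr]].

Definition gap_code : prog :=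
  [:: If rVl rVr [:: Arith Defs.Sub rG rVr rVl] [:: Arith Defs.Sub rG rVl rVr]].

Definition sum_code : prog := [:: Arith Mul rA rG rD; Arith Add rE rE rA].

(** [rW] holds the variate minus the mass of the cells already passed. The only test being
    non-strict, [0 < rW] is the second branch of [rW <= 0]. *)
Definition pick_code : prog :=
  [:: Arith Mul rC rG rD; Arith Div rC rC rS;
      If rW rZ [::] [:: If rW rC [:: Arith Mul rA rW rS; Arith Div rA rA rG;
                                     Arith Add rE rNl rA] [::]];
      Arith Defs.Sub rW rW rC].

Definition eval_code : prog :=
  [:: If rY rNl [::] [:: If rY rNr [:: Arith Add rE rE rG] [::]]].

Definition cells (height act : prog) : prog :=
  flatten (nseq 128 (advance ++ height ++ act ++ [:: Copy rNl rNr; Copy rVl rVr])).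

Definition tail_pick (o : arith) : prog :=
  [:: If rW rZ [::] [:: If rW rC [:: Const rA 4; Arith Div rA rA rH;
                                     Arith Div rA rA rW; Arith o rE rM rA] [::]];
      Arith Defs.Sub rW rW rC].

Definition gen_upper : prog :=
  prelude ++ [:: Const rS 1; Draw rW] ++ cells gap_code pick_code ++
  [:: Const rC 1; Const rA 4; Arith Div rC rC rA] ++
  tail_pick Defs.Sub ++ tail_pick Add ++ [:: Copy rY rE].

(** The normalising constant must be known before inversion, hence two scans; the second [prelude]
    preserves [rS]. *)
Definition gen_lower : prog :=
  prelude ++ cells low_code sum_code ++ [:: Copy rS rE] ++
  prelude ++ [:: Draw rW] ++ cells low_code pick_code ++ [:: Copy rX rE].

Definition eval_lower : prog :=
  prelude ++ cells low_code eval_code ++ [:: Copy rR rE].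

Definition eval_upper : prog :=
  prelude ++ cells gap_code eval_code ++
  [:: Const rA 16; Arith Div rA rA rH; Arith Mul rA rA rA;
      Arith Defs.Sub rB rY rM; Arith Mul rB rB rB;
      If rA rB [:: Const rA 4; Arith Div rA rA rH; Arith Div rA rA rB;
                   Arith Add rE rE rA] [::];
      Copy rQ rE].

(** The mass of [q] is [1] for every [f], so the set-up is a constant and stores no data. *)
Definition sampler : ac_impl :=
  AcImpl 0 [:: Const rI 1] gen_upper gen_lower eval_upper eval_lower.

(** * Correctness of the programs *)

Section Correctness.
Context {R : realType} (f : R -> R) (u : nat -> R) (m : R).
Implicit Types (s : nat -> R) (k i : nat).
Local Notation exec := (exec f u).
Local Notation width := (width f m).
Local Notation node := (node f m).
Local Notation value := (value f m).

Definition at_cell i s : Prop :=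
  [/\ s rJ = i%:R, s rD = width, s rNl = node i, s rVl = value i & s rZ = 0].

Lemma prelude_spec s k : s rM = m -> exists s',
  [/\ exec prelude (s, k) = (s', k), at_cell 0 s', s' rE = 0, s' rH = f m
    & forall j, (j < 12)%N -> s' j = s j].
Proof.
move=> sm; eexists; split; first by reflexivity.
- rewrite /at_cell /upd /= sm /width /node /width; split => //.
  by rewrite mul0r addr0.
- by [].
- by rewrite /upd /= sm.
- by move=> j j12; do 12?[case: j j12 => [//|j] j12].
Qed.

Definition height_code (p : prog) (h : nat -> R) : Prop :=
  forall s k i, s rVl = value i -> s rVr = value i.+1 -> exists s',
  [/\ exec p (s, k) = (s', k), s' rG = h i & forall j, j != rG -> s' j = s j].

Lemma low_code_spec : height_code low_code (low f m).
Proof.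
move=> s k i sl sr; rewrite /exec /= sl sr /low.
case: ifP => _; eexists; split; try reflexivity;
  by [rewrite /upd /=|move=> j jG; rewrite /upd (negbTE jG)].
Qed.

Lemma gap_code_spec : height_code gap_code (gap f m).
Proof.
move=> s k i sl sr; rewrite /exec /= sl sr /gap.
case: ifP => _; eexists; split; try reflexivity;
  by [rewrite /upd /= ?sl ?sr|move=> j jG; rewrite /upd (negbTE jG)].
Qed.

Lemma advance_spec p h s k i : height_code p h -> at_cell i s -> exists s',
  [/\ exec (advance ++ p) (s, k) = (s', k),
      [/\ s' rJ = i.+1%:R, s' rNr = node i.+1, s' rVr = value i.+1 & s' rG = h i]
    & forall j, j \notin [:: rJ; rNr; rVr; rG; rA] -> s' j = s j].
Proof.
move=> hp [sJ sD sN sV sZ]; rewrite exec_cat.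
have [s1 [e1 [J1 N1 V1] F1]] : exists s1, [/\ exec advance (s, k) = (s1, k),
    [/\ s1 rJ = i.+1%:R, s1 rNr = node i.+1 & s1 rVr = value i.+1]
  & forall j, j \notin [:: rJ; rNr; rVr; rA] -> s1 j = s j].
  have vE : value i.+1 = if (128 <= i.+1)%N then 0 else f (node i.+1) by [].
  rewrite /exec /=; set b := (_ <= _).
  have -> : b = (128 <= i.+1)%N by rewrite /b /upd /= sJ natr1 ler_nat.
  case: ifP => i128; eexists; split; try reflexivity.
  - by split; rewrite /upd /= ?sJ ?sN ?sD ?natr1 -?nodeS// vE i128.
  - by move=> j; rewrite !inE !negb_or /upd /= => /and4P[/negbTE-> /negbTE-> /negbTE-> /negbTE->].
  - by split; rewrite /upd /= ?sJ ?sN ?sD ?natr1 -?nodeS// vE i128.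
  - by move=> j; rewrite !inE !negb_or /upd /= => /and4P[/negbTE-> /negbTE-> /negbTE-> /negbTE->].
rewrite e1; have V1l : s1 rVl = value i by rewrite F1.
have [s2 [e2 G2 F2]] := hp s1 k i V1l V1.
exists s2; split=> //; first by split=> //; rewrite F2.
move=> j; rewrite !inE !negb_or => /and5P[jJ jN jV jG jA].
by rewrite F2// F1// !inE !negb_or jJ jN jV jA.
Qed.

(** Invariant rule for the unrolled scan. [P] must ignore the registers that the scan itself
    changes, and [act] may only touch its own four. *)
Lemma cells_spec p h act (P : nat -> (nat -> R) -> Prop) n s k :
  height_code p h ->
  (forall i s s', P i s -> (forall j, j \notin [:: rJ; rNl; rVl; rNr; rVr; rG; rA] ->
     s' j = s j) -> P i s') ->
  (forall i s k, P i s -> s rD = width -> s rNl = node i -> s rNr = node i.+1 ->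
     s rG = h i -> s rZ = 0 -> exists s', [/\ exec act (s, k) = (s', k), P i.+1 s'
     & forall j, j \notin [:: rW; rC; rA; rE] -> s' j = s j]) ->
  at_cell 0 s -> P 0%N s -> exists s',
  [/\ exec (flatten (nseq n (advance ++ p ++ act ++ [:: Copy rNl rNr; Copy rVl rVr]))) (s, k)
        = (s', k), at_cell n s', P n s'
    & forall j, j \notin [:: rW; rJ; rNl; rVl; rNr; rVr; rG; rC; rA; rE] -> s' j = s j].
Proof.
move=> hp Pext hact at0 P0; rewrite exec_nseq.
elim: n => [|n [s1 [e1 at1 P1 F1]]]; first by exists s.
rewrite iterS e1 catA exec_cat.
have [s2 [-> [J2 N2 V2 G2] F2]] := advance_spec p h s1 k n hp at1.
have [J1 D1 Nl1 Vl1 Z1] := at1.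
have P2 : P n s2.
  apply: Pext P1 _ => j; rewrite !inE !negb_or => /and5P[jJ jNl jVl jNr /and3P[jVr jG jA]].
  by rewrite F2// !inE !negb_or jJ jNr jVr jG jA.
have [s3 [e3 P3 F3]] : exists s', [/\ exec act (s2, k) = (s', k), P n.+1 s'
    & forall j, j \notin [:: rW; rC; rA; rE] -> s' j = s2 j].
  by apply: hact => //; rewrite F2.
rewrite exec_cat e3; eexists; split; first by reflexivity.
- split; rewrite /upd /=.
  + by rewrite F3.
  + by rewrite F3// F2.
  + by rewrite F3.
  + by rewrite F3.
  + by rewrite F3// F2.
- apply: Pext P3 _ => j; rewrite !inE !negb_or /upd /= => /and5P[_ /negbTE-> /negbTE-> _ _].
  by [].
- move=> j jn; have := jn; rewrite !inE !negb_or /upd.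
  move=> /and5P[jW jJ jNl jVl /and5P[jNr jVr jG jC /andP[jA jE]]].
  rewrite (negbTE jNl) (negbTE jVl) F3 ?inE ?negb_or ?jW ?jC ?jA//.
  by rewrite F2 ?inE ?negb_or ?jJ ?jNr ?jVr ?jG ?jA// F1.
Qed.

Lemma sum_spec p h s k : height_code p h -> at_cell 0 s -> s rE = 0 -> exists s',
  [/\ exec (cells p sum_code) (s, k) = (s', k),
      s' rE = \sum_(i < 128) h i * width
    & forall j, j \notin [:: rW; rJ; rNl; rVl; rNr; rVr; rG; rC; rA; rE] -> s' j = s j].
Proof.
move=> hp at0 E0.
have [||||s' [e at' P' F']] := cells_spec p h sum_code
  (fun i s => s rE = \sum_(i0 < i) h i0 * width) 128 s k hp.
- by move=> i s1 s2 e1 F; rewrite F.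
- move=> i s1 k1 e1 sD _ _ sG _; eexists; split; first by reflexivity.
  + by rewrite /upd /= e1 sG sD big_ord_recr.
  + by move=> j; rewrite !inE !negb_or /upd /= => /and4P[]
      /negbTE jW /negbTE jC /negbTE jA /negbTE jE; rewrite ?jW ?jC ?jA ?jE.
- exact: at0.
- by rewrite big_ord0.
by exists s'.
Qed.

Lemma pick_spec p h s k : height_code p h -> at_cell 0 s -> s rE = 0 -> exists s',
  [/\ exec (cells p pick_code) (s, k) = (s', k),
      s' rE = steps_inv f m h (s rS) (s rW),
      s' rW = s rW - cell_mass f m h (s rS) 128, s' rZ = 0
    & forall j, j \notin [:: rW; rJ; rNl; rVl; rNr; rVr; rG; rC; rA; rE] -> s' j = s j].
Proof.
move=> hp at0 E0; set w := s rW; set S := s rS.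
pose C := cell_mass f m h S.
have CS i : C i.+1 = C i + h i * width / S by rewrite /C /cell_mass big_ord_recr.
have [||||s' [e [_ _ _ _ Z'] [W' S' E'] F']] := cells_spec p h pick_code
  (fun i s => [/\ s rW = w - C i, s rS = S & s rE = inversion C (cell_inv f m h S) i w])
  128 s k hp.
- by move=> i s1 s2 [W1 S1 E1] F; split; rewrite F.
- move=> i s1 k1 [W1 S1 E1] sD sNl sNr sG sZ.
  have cE : s1 rG * s1 rD / s1 rS = h i * width / S by rewrite sG sD S1.
  have WE : s1 rW - s1 rG * s1 rD / s1 rS = w - C i.+1.
    by rewrite W1 cE CS opprD addrA.
  rewrite /exec /=; set b1 := (_ <= _).
  have -> : b1 = (w <= C i) by rewrite /b1 /upd /= W1 sZ subr_le0.
  case: ifPn => wC.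
    eexists; split; first by reflexivity.
    + by rewrite /upd /= WE ltNge wC.
    + by move=> j; rewrite !inE !negb_or /upd /= => /and4P[]
      /negbTE jW /negbTE jC /negbTE jA /negbTE jE; rewrite ?jW ?jC ?jA ?jE.
  rewrite /=; set b2 := (_ <= _).
  have -> : b2 = (w <= C i.+1).
    by rewrite /b2 /upd /= cE W1 lerBlDl CS.
  case: ifPn => wC'.
    eexists; split; first by reflexivity.
    + by rewrite /upd /= WE ltNge wC S1 sNl W1 sG.
    + by move=> j; rewrite !inE !negb_or /upd /= => /and4P[]
      /negbTE jW /negbTE jC /negbTE jA /negbTE jE; rewrite ?jW ?jC ?jA ?jE.
  eexists; split; first by reflexivity.
  + by rewrite /upd /= WE andbF.
  + by move=> j; rewrite !inE !negb_or /upd /= => /and4P[]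
      /negbTE jW /negbTE jC /negbTE jA /negbTE jE; rewrite ?jW ?jC ?jA ?jE.
- exact: at0.
- by rewrite /C /cell_mass big_ord0 subr0.
by exists s'; split.
Qed.

Lemma eval_spec p h s k : height_code p h -> at_cell 0 s -> s rE = 0 -> exists s',
  [/\ exec (cells p eval_code) (s, k) = (s', k),
      s' rE = steps f m h (s rY)
    & forall j, j \notin [:: rW; rJ; rNl; rVl; rNr; rVr; rG; rC; rA; rE] -> s' j = s j].
Proof.
move=> hp at0 E0; set y := s rY.
have [||||s' [e _ [_ E'] F']] := cells_spec p h eval_code
  (fun i s => s rY = y /\ s rE = \sum_(i0 < i) h i0 * \1_(cell f m i0) y) 128 s k hp.
- by move=> i s1 s2 [Y1 E1] F; rewrite !F.
- move=> i s1 k1 [Y1 E1] sD sNl sNr sG sZ.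
  rewrite big_ord_recr/= indicE.
  have yE : (y \in cell f m i) = (node i < y <= node i.+1).
    by apply/idP/idP; rewrite inE /cell/= in_itv.
  rewrite yE /exec /= Y1 sNl sNr.
  case: ifPn => ly /=.
    by exists s1; rewrite ltNge ly mulr0 addr0.
  case: ifPn => yr /=; last first.
    by exists s1; rewrite andbF mulr0 addr0.
  eexists; split; first by reflexivity.
  + by rewrite /upd /= E1 sG ltNge ly mulr1.
  + by move=> j; rewrite !inE !negb_or /upd /= => /and4P[]
      /negbTE jW /negbTE jC /negbTE jA /negbTE jE; rewrite ?jW ?jC ?jA ?jE.
- exact: at0.
- by rewrite big_ord0.
by exists s'.
Qed.

Lemma gen_lower_spec s k : s rM = m -> exists s',
  exec gen_lower (s, k) = (s', k.+1) /\ s' rX = lower_inv f m (u k).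
Proof.
move=> sM; rewrite /gen_lower exec_cat.
have [s1 [-> at1 E1 _ F1]] := prelude_spec s k sM.
rewrite exec_cat.
have [s2 [-> E2 F2]] := sum_spec _ _ s1 k low_code_spec at1 E1.
pose s3 := upd s2 rS (s2 rE).
have -> : exec ([:: Copy rS rE] ++ prelude ++ [:: Draw rW] ++ cells low_code pick_code ++
  [:: Copy rX rE]) (s2, k) = exec (prelude ++ [:: Draw rW] ++ cells low_code pick_code ++
  [:: Copy rX rE]) (s3, k) by [].
rewrite exec_cat.
have [|s4 [-> at4 E4 _ F4]] := prelude_spec s3 k; first by rewrite /s3 /upd /= F2// F1.
pose s5 := upd s4 rW (u k).
rewrite exec_cat -/(s5, k.+1) [X in exec _ X](_ : _ = (s5, k.+1))// exec_cat.
have [||s6 [-> E6 _ _ _]] := pick_spec _ _ s5 k.+1 low_code_spec; [exact: at4|exact: E4|].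
eexists; split; first by reflexivity.
rewrite /upd /= E6 /lower_inv; congr steps_inv => //.
by rewrite /s5 /upd /= F4// /s3 /upd /= E2.
Qed.

Lemma gen_upper_spec s k : s rM = m -> exists s',
  exec gen_upper (s, k) = (s', k.+1) /\ s' rY = upper_inv f m (u k).
Proof.
move=> sM; rewrite /gen_upper exec_cat.
have [s1 [-> at1 E1 H1 F1]] := prelude_spec s k sM.
rewrite exec_cat.
pose s2 := upd (upd s1 rS 1) rW (u k).
rewrite [X in exec _ X](_ : _ = (s2, k.+1))// exec_cat.
have [||s3 [-> E3 W3 Z3 F3]] := pick_spec _ _ s2 k.+1 gap_code_spec; [exact: at1|exact: E1|].
have H3 : s3 rH = f m by rewrite F3.
have M3 : s3 rM = m by rewrite F3// /s2 /upd /= F1.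
have S2 : s2 rS = 1 by [].
have W2 : s2 rW = u k by [].
rewrite S2 W2 in E3 W3.
rewrite /upper_inv.
set w1 := u k - _ in W3 *.
set w2 := w1 - 1 / 4.
rewrite exec_cat [X in exec _ X](_ : _ = (upd (upd (upd s3 rC 1) rA 4) rC (1 / 4), k.+1))//.
set s4 := upd _ rC _.
have tailE o s' W E : s' rW = W -> s' rE = E -> s' rZ = 0 -> s' rH = f m -> s' rM = m ->
  s' rC = 1 / 4 -> exists s'',
  [/\ exec (tail_pick o) (s', k.+1) = (s'', k.+1),
      s'' rW = W - 1 / 4,
      s'' rE = if 0 < W <= 1 / 4 then arith_op o m (4 / f m / W) else E
    & forall j, j \notin [:: rW; rA; rE] -> s'' j = s' j].
  move=> W' E' Z' H' M' C'; rewrite /exec /= W' Z'.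
  case: ifPn => W0 /=.
    eexists; split; first by reflexivity.
    + by rewrite /upd /= ?W' ?C'.
    + by rewrite /upd /= ?E' ltNge W0.
    + by move=> j; rewrite !inE !negb_or /upd /= => /and3P[]
      /negbTE jW /negbTE jA /negbTE jE; rewrite ?jW ?jA ?jE.
  rewrite ?W' ?C'; case: ifPn => WC /=.
    eexists; split; first by reflexivity.
    + by rewrite /upd /= ?W' ?C'.
    + by rewrite /upd /= ?H' ?M' ?W' ltNge W0 ?WC.
    + by move=> j; rewrite !inE !negb_or /upd /= => /and3P[]
      /negbTE jW /negbTE jA /negbTE jE; rewrite ?jW ?jA ?jE.
  eexists; split; first by reflexivity.
  + by rewrite /upd /= ?W' ?C'.
  + by rewrite /upd /= ?E' ?(negbTE WC) andbF.
  + by move=> j; rewrite !inE !negb_or /upd /= => /and3P[]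
      /negbTE jW /negbTE jA /negbTE jE; rewrite ?jW ?jA ?jE.
rewrite exec_cat.
have [||||||s5 [-> W5 E5 F5]] := tailE Defs.Sub s4 w1 (s3 rE) => //.
rewrite exec_cat.
have [||||s6 [-> W6 E6 F6]] := tailE Add s5 w2 (s5 rE) W5 erefl; try by rewrite F5.
eexists; split; first by reflexivity.
rewrite [LHS]/upd /= E6 E5 E3.
reflexivity.
Qed.

Lemma eval_lower_spec s k : s rM = m -> exists s',
  exec eval_lower (s, k) = (s', k) /\ s' rR = lower f m (s rY).
Proof.
move=> sM; rewrite /eval_lower exec_cat.
have [s1 [-> at1 E1 _ F1]] := prelude_spec s k sM.
rewrite exec_cat.
have [s2 [-> E2 _]] := eval_spec _ _ s1 k low_code_spec at1 E1.
eexists; split; first by reflexivity.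
by rewrite /upd /= E2 F1.
Qed.

Lemma eval_upper_spec s k : s rM = m -> exists s',
  exec eval_upper (s, k) = (s', k) /\ s' rQ = upper f m (s rY).
Proof.
move=> sM; rewrite /eval_upper exec_cat.
have [s1 [-> at1 E1 H1 F1]] := prelude_spec s k sM.
rewrite exec_cat.
have [s2 [-> E2 F2]] := eval_spec _ _ s1 k gap_code_spec at1 E1.
have H2 : s2 rH = f m by rewrite F2.
have M2 : s2 rM = m by rewrite F2// F1.
have Y2 : s2 rY = s rY by rewrite F2// F1.
rewrite F1// in E2.
rewrite /exec /=; set b := (_ <= _).
have -> : b = ((16 / f m) * (16 / f m) <= (s rY - m) * (s rY - m)).
  by rewrite /b /upd /= H2 M2 Y2.
rewrite /upper /tail; case: ifP => _; eexists; split; try reflexivity.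
  by rewrite /upd /= E2 H2 M2 Y2.
by rewrite /upd /= E2 addr0.
Qed.

End Correctness.

Lemma writes_gen_upper :
  writes_in (fun j => (10 <= j)%N || (j == rY)) gen_upper.
Proof. by vm_compute. Qed.

Lemma writes_gen_lower :
  writes_in (fun j => (10 <= j)%N || (j == rX)) gen_lower.
Proof. by vm_compute. Qed.

Lemma writes_eval_upper :
  writes_in (fun j => (10 <= j)%N || (j == rQ)) eval_upper.
Proof. by vm_compute. Qed.

Lemma writes_eval_lower :
  writes_in (fun j => (10 <= j)%N || (j == rR)) eval_lower.
Proof. by vm_compute. Qed.

(** With the trivial predicate, only the absence of loops is certified. *)
Lemma writes_sampler : writes_in xpredT (ac_program sampler).
Proof. by vm_compute. Qed.

(** * Output, law and cost of the whole method *)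

Section Final.
Context {R : realType}.
Local Notation mu := (@lebesgue_measure R).
Local Notation unif := (uniform_prob (@ltr01 R)).

(** Each sampler consumes exactly one variate, so the order is [V], the candidate, [U], the
    replacement. *)
Lemma sampler_output (f : R -> R) (u : nat -> R) (m : R) : 0 <= u 0%N ->
  let y := upper_inv f m (u 1%N) in
  (exec f u (ac_program sampler) (init m, 0%N)).1 rX =
  if u 2%N * upper f m y <= f y - lower f m y then y else lower_inv f m (u 3%N).
Proof.
move=> u0 y; rewrite /ac_program exec_cat.
set s0 := upd (init m) rI 1.
rewrite [X in exec f u _ X](_ : _ = (s0, 0%N)); last by [].
set s1 := upd (upd (upd s0 rV (u 0%N)) rT 1) rT (1 - 1).
rewrite -[ac_gen_r sampler]/gen_lower -[ac_gen_q sampler]/gen_upper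
  -[ac_eval_q sampler]/eval_upper -[ac_eval_r sampler]/eval_lower.
set p1 := _ ++ [:: Draw rU] ++ _.
set p2 := gen_lower.
have -> : exec f u [:: Draw rV; Const rT 1; Arith Defs.Sub rT rT rI; If rT rV p1 p2] (s0, 0%N)
    = exec f u [:: If rT rV p1 p2] (s1, 1%N) by [].
(* The threshold is [1 - 1 = 0], so the test on [V] passes. *)
rewrite exec_If (_ : s1 rT = 0) ?[s1 rV]/(u 0%N) ?u0; last by rewrite /s1 /upd /= subrr.
rewrite /p1 exec_cat.
have sM : s1 rM = m by [].
have [s2 [e2 Y2]] := gen_upper_spec f u m s1 1 sM.
rewrite -/y in Y2; clearbody y.
have F2 j : (j < 10)%N -> j != rY -> s2 j = s1 j.
  move=> j10 jY; have := exec_frame f u _ _ j s1 1 writes_gen_upper.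
  by rewrite e2; apply; rewrite negb_or -ltnNge j10.
rewrite e2 exec_cat.
pose s3 := upd s2 rU (u 2%N).
rewrite [X in exec f u _ X](_ : _ = (s3, 3%N)); last by [].
rewrite exec_cat.
have M3 : s3 rM = m by exact: (F2 rM isT isT).
have [s4 [e4 Q4]] := eval_upper_spec f u m s3 3 M3.
have F4 j : (j < 10)%N -> j != rQ -> s4 j = s3 j.
  move=> j10 jY; have := exec_frame f u _ _ j s3 3 writes_eval_upper.
  by rewrite e4; apply; rewrite negb_or -ltnNge j10.
rewrite e4 exec_cat.
have M4 : s4 rM = m by rewrite (F4 rM isT isT).
have [s5 [e5 R5]] := eval_lower_spec f u m s4 3 M4.
have F5 j : (j < 10)%N -> j != rR -> s5 j = s4 j.
  move=> j10 jY; have := exec_frame f u _ _ j s4 3 writes_eval_lower.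
  by rewrite e5; apply; rewrite negb_or -ltnNge j10.
rewrite e5.
have Y3 : s3 rY = y by rewrite /s3 /upd /= Y2.
have Y5 : s5 rY = y by rewrite (F5 rY isT isT) (F4 rY isT isT).
have Q5 : s5 rQ = upper f m y by rewrite (F5 rQ isT isT) Q4 Y3.
have {}R5 : s5 rR = lower f m y by rewrite R5 (F4 rY isT isT) Y3.
have U5 : s5 rU = u 2%N by rewrite (F5 rU isT isT) (F4 rU isT isT).
set s6 := upd (upd (upd s5 rF (f (s5 rY))) rF (f (s5 rY) - s5 rR)) rT (s5 rU * s5 rQ).
rewrite (_ : exec f u _ (s5, 3%N) = exec f u [:: If rT rF [:: Copy rX rY] p2] (s6, 3%N)); last by [].
rewrite exec_If [s6 rT]/(s5 rU * s5 rQ) [s6 rF]/(f (s5 rY) - s5 rR) U5 Q5 Y5 R5.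
case: ifP => _; first exact: Y5.
have M6 : s6 rM = m by rewrite [LHS](F5 rM isT isT).
have [s7 [e7 X7]] := gen_lower_spec f u m s6 3 M6.
by rewrite e7.
Qed.

Lemma transports_mass (D : set R) (psi g : R -> R) : transports D psi g ->
  (\int[mu]_x (g x)%:E)%E = mu D.
Proof. by move=> H; rewrite -H// preimage_setT setIT. Qed.

Section Law.
Context {f : R -> R} {m : R}.
Hypotheses (fd : density f) (flc : log_concave f) (fm : mode f m).

(** The total mass is the length of the interval of variates that is transported onto it. *)
Lemma integral_upper : (\int[mu]_x (upper f m x)%:E)%E = 1%E.
Proof.
rewrite (transports_mass _ _ _ (transports_upper fd flc fm)).
by rewrite lebesgue_itvoc subr0 max_r.
Qed.

Lemma low_mass_ge0 : 0 <= low_mass f m.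
Proof.
apply: sumr_ge0 => i _; rewrite mulr_ge0 ?(low_ge0 fd)//.
by rewrite ltW// (width_gt0 fd fm).
Qed.

Lemma lower_ge0 x : 0 <= lower f m x.
Proof. by apply: steps_ge0 => i; exact: low_ge0 fd _. Qed.

Lemma upper_ge0 x : 0 <= upper f m x.
Proof.
apply: addr_ge0; [by apply: steps_ge0 => i; exact: gap_ge0|exact: (tail_ge0 fd)].
Qed.

Lemma integral_lower : (\int[mu]_x (lower f m x)%:E)%E = (low_mass f m)%:E.
Proof.
have := transports_mass _ _ _ (transports_steps fd fm (low f m) 1 ltr01 (low_ge0 fd)).
under eq_integral do rewrite divr1.
move=> ->; rewrite lebesgue_itvoc subr0.
have -> : cell_mass f m (low f m) 1 128 = low_mass f m.
  by apply: eq_bigr => i _; rewrite divr1.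
by rewrite max_r// low_mass_ge0.
Qed.

Lemma integ_upper : integ (upper f m) = 1.
Proof. by rewrite /integ /Rintegral integral_upper. Qed.

Lemma integ_lower : integ (lower f m) = low_mass f m.
Proof. by rewrite /integ /Rintegral integral_lower. Qed.

Lemma integrable_ge0 (g : R -> R) (c : R) : measurable_fun setT g ->
  (forall x, 0 <= g x) -> (\int[mu]_x (g x)%:E)%E = c%:E ->
  mu.-integrable setT (EFin \o g).
Proof.
move=> mg g0 gc; apply/integrableP; split; first exact: measurableT_comp.
rewrite [ltLHS](_ : _ = c%:E) ?ltry// -gc.
by apply: eq_integral => x _; rewrite gee0_abs ?lee_fin.
Qed.

Lemma ac_pair_envelope : ac_pair f (lower f m) (upper f m).
Proof.
split.
- by move=> x; split; [exact: lower_ge0|exact: upper_ge0].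
- by move=> x; exact: (lower_upper fd flc fm).
- exact: integrable_ge0 (measurable_lower f m) lower_ge0 integral_lower.
- exact: integrable_ge0 (measurable_upper f m) upper_ge0 integral_upper.
- by rewrite integ_upper.
Qed.

Lemma uniform_transport d (T : measurableType d) (P : probability T R)
    (U : {RV P >-> R}) (psi g : R -> R) (mpsi : measurable_fun setT psi) :
  (forall A : set R, measurable A -> distribution P U A = unif A) ->
  transports `]0, 1] psi g ->
  exists2 X : {RV P >-> R}, (forall w, X w = psi (U w)) & has_density X g.
Proof.
move=> HU H.
have mX : measurable_fun setT (psi \o U) by exact: measurableT_comp.
pose X : {RV P >-> R} := HB.pack (psi \o U) (isMeasurableFun.Build _ _ _ _ _ mX).
exists X => // A mA.
rewrite -(transports_uniform _ _ mpsi H)// -HU//.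
by rewrite -[X in measurable X]setTI; exact: mpsi.
Qed.

Lemma sampler_implements : ac_implements sampler f m.
Proof.
exists (lower f m), (upper f m); split; first exact: ac_pair_envelope.
move=> u _; exists 1%N, (upd (init m) rI 1), 0%N; split => //.
  by rewrite integ_upper.
move=> s sE; have sM : s rM = m by rewrite sE.
split.
(* A routine considered alone counts variates from [0], hence [U 0] here, whereas the full program
   hands it a later one. *)
- split=> [v _|_ d T P U [_ HU _]].
    have [s' [e Y]] := gen_upper_spec f v m s 0 sM.
    exists (upper_inv f m (v 0%N)); apply: returns_exec writes_gen_upper _.
    by rewrite e.
  have [X XE Xd] := uniform_transport _ _ _ (U 0%N) _ _ (measurable_upper_inv f m)
    (HU 0%N) (transports_upper fd flc fm).
  exists X; split.
    move=> w; have [s' [e Y]] := gen_upper_spec f (fun k => U k w) m s 0 sM.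
    by apply: returns_exec writes_gen_upper _; rewrite e XE.
  by move=> A mA; rewrite Xd//; apply: eq_integral => x _; rewrite integ_upper divr1.
- split=> [v _|S0 d T P U [_ HU _]].
    have [s' [e Y]] := gen_lower_spec f v m s 0 sM.
    exists (lower_inv f m (v 0%N)); apply: returns_exec writes_gen_lower _.
    by rewrite e.
  rewrite integ_lower in S0 *.
  have [X XE Xd] := uniform_transport _ _ _ (U 0%N) _ _ (measurable_lower_inv f m)
    (HU 0%N) (transports_lower fd fm S0).
  exists X; split=> //.
  move=> w; have [s' [e Y]] := gen_lower_spec f (fun k => U k w) m s 0 sM.
  by apply: returns_exec writes_gen_lower _; rewrite e XE.
- move=> v _; have [s' [e Y]] := eval_upper_spec f v m s 0 sM.
  by apply: returns_exec writes_eval_upper _; rewrite e.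
- move=> v _; have [s' [e Y]] := eval_lower_spec f v m s 0 sM.
  by apply: returns_exec writes_eval_lower _; rewrite e.
Qed.

Lemma sampler_law d (T : measurableType d) (P : probability T R)
    (U : nat -> {RV P >-> R}) : iid_uniform U ->
  exists X : {RV P >-> R},
    (forall w, X w = (exec f (fun k => U k w) (ac_program sampler) (init m, 0%N)).1 rX) /\
    has_density X f.
Proof.
move=> iidU; have [U01 _ _] := iidU.
have [X XE Xd] := acceptance_complement_law _ _ _ U f _ _ _ _ _ fd (measurable_upper f m)
  (measurable_lower f m) lower_ge0 (lower_upper fd flc fm) (measurable_upper_inv f m)
  (transports_upper fd flc fm) (measurable_lower_inv f m) integral_lower
  (transports_lower fd fm) iidU.
exists X; split=> // w; rewrite sampler_output ?XE//.
by have /andP[] := U01 w 0%N.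
Qed.

End Law.
End Final.

Theorem theorem1 (R : realType) :
  exists (C : nat) (A : ac_impl),
    forall (f : R -> R) (m : R),
      density f -> log_concave f -> mode f m ->
      [/\ ac_implements A f m,
          (forall u : nat -> R, in_unit u ->
             halted (run f u C (ac_start A m)))
        & (forall d (T : measurableType d) (P : probability T R)
             (U : nat -> {RV P >-> R}), iid_uniform U ->
           exists X : {RV P >-> R},
             (forall w, X w =
                register (run f (fun k => U k w) C (ac_start A m)) rX) /\
             has_density X f)].
Proof.
(* The bound is computed from the program text alone, so it depends on neither [f], [m] nor the
   draws. *)
exists (cost (ac_program sampler)), sampler => f m fd flc fm.
have runE u := run_halted f u _ _ (init m) 0 _ writes_sampler (leqnn (cost (ac_program sampler))).
split; first exact: sampler_implements.
- by move=> u _; rewrite /halted /ac_start runE.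
- move=> d T P U iidU; have [X [XE Xd]] := sampler_law fd flc fm _ _ P U iidU.
  by exists X; split=> // w; rewrite XE /register /ac_start runE.
Qed.
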